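(* The $\mathbb Q$-algebra ${\rm sQSym}$ of quasisymmetric functions in superspace, with the coproduct $\Delta$, is a commutative (in the signed sense, $fg=(-1)^{\deg(f)\deg(g)}gf$ for $f,g$ homogeneous in the fermionic degree $\deg$) graded connected Hopf algebra. Moreover, it contains the ring $\mathbf{\Lambda}$ of symmetric functions in superspace as a Hopf subalgebra.
   Context: Variables $x_1,x_2,\dots$ commute; $\theta_1,\theta_2,\dots$ anticommute ($\theta_i\theta_j=-\theta_j\theta_i$, $\theta_i^2=0$). The total degree is the degree in the $x$'s and the fermionic degree, denoted $\deg$, is the degree in the $\theta$'s. A dotted composition $\alpha=(\alpha_1,\dots,\alpha_l)$ is a finite (possibly empty) sequence whose entries belong to $\{1,2,3,\dots\}$ (non-dotted) or $\{\dot0,\dot1,\dot2,\dots\}$ (dotted). Put $\eta_i=1$ if $\alpha_i$ is dotted and $\eta_i=0$ otherwise. ${\rm sQSym}$ is the $\mathbb Q$-vector space of formal power series $f$ of bounded degree in these variables such that, for every dotted composition $\alpha$, all monomials $\theta_{i_1}^{\eta_1}\cdots\theta_{i_l}^{\eta_l}x_{i_1}^{\alpha_1}\cdots x_{i_l}^{\alpha_l}$ with $i_1<\cdots<i_l$ have the same coefficient in $f$ (dots ignored in exponents). It is closed under multiplication of power series. The grading is ${\rm sQSym}=\bigoplus_n{\rm sQSym}_n$, with ${\rm sQSym}_n$ the span of elements whose total degree plus fermionic degree is $n$; connected means ${\rm sQSym}_0$ is one-dimensional. ${\rm sQSym}\otimes{\rm sQSym}$ is identified with functions, quasisymmetric in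 each set, of two sets of variables $(x;\theta)$ and $(y;\phi)$, ordered by $x_1<x_2<\cdots<y_1<y_2<\cdots$ and $\theta_1<\theta_2<\cdots<\phi_1<\phi_2<\cdots$, with the $\theta$'s and $\phi$'s anticommuting with each other; $f\otimes g$ corresponds to $f(x;\theta)g(y;\phi)$, so $(f_1\otimes g_1)(f_2\otimes g_2)=(-1)^{\deg(g_1)\deg(f_2)}f_1f_2\otimes g_1g_2$. The coproduct is $(\Delta f)(x,y;\theta,\phi)=f(x,y;\theta,\phi)$, i.e. $f$ evaluated on the ordered union of the two sets. The counit $\epsilon$ is the identity on ${\rm sQSym}_0=\mathbb Q$ and zero on ${\rm sQSym}_n$, $n>0$. A graded Hopf algebra here means: an associative unital algebra that is a coassociative counital coalgebra, with $\Delta$ and $\epsilon$ algebra morphisms (the tensor square carrying the signed product above), with product and coproduct respecting the grading, possessing an antipode, i.e. a linear map $S$ with $\mathrm{mult}\circ(S\otimes1)\circ\Delta=u\circ\epsilon=\mathrm{mult}\circ(1\otimes S)\circ\Delta$ ($\mathrm{mult}$ the multiplication, $u$ the unit map). $\mathbf{\Lambda}$ is the ring of bounded-degree formal power series over $\mathbb Q$ in the same variables invariant under simultaneous permutation of the pairs $(x_i,\theta_i)$, with its own Hopf algebra structure: the coproduct is $(\Delta f)(x,y;\theta,\phi)=f(x,y;\theta,\phi)$, where $f\otimes g\in\mathbf{\Lambda}\otimes\mathbf{\Lambda}$ is identified with $f(x;\theta)g(y;\phi)$ ($\theta$'s and $\phi$'s anticommuting), and the counit is the projection on constants. *)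

(* Defs.v *)
From HB Require Import structures.
From mathcomp Require Import all_boot all_order all_algebra finmap.
From mathcomp Require Import boolp classical_sets functions cardinality fsbigop.

Set Implicit Arguments.
Unset Strict Implicit.
Unset Printing Implicit Defensive.

Import Order.TTheory GRing.Theory Num.Theory.

Local Open Scope classical_set_scope.
Local Open Scope ring_scope.

(* A monomial in commuting x_i and anticommuting theta_i, i in a totally ordered
   alphabet I: m i = (eta, a) stands for theta_i^eta x_i^a, the thetas being
   written in increasing order of their indices. *)
Definition mono d (I : orderType d) :=
  {fsfun I -> bool * nat with (false, 0%N)}.

Section Monomials.
Context {d : Order.disp_t} {I : orderType d}.
Implicit Types (a b c m : mono I).

Definition mono1 : mono I := [fsfun].

(* The monomial underlying the product of a and b, whose coefficient is
   msign a b. If a theta is repeated the value is irrelevant: msign a b = 0. *)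
Definition mmul a b : mono I :=
  [fsfun i in (finsupp a `|` finsupp b)%fset =>
     ((a i).1 || (b i).1, (a i).2 + (b i).2)%N].

Definition tsupp m : {fset I} := [fset i in finsupp m | (m i).1]%fset.

(* The sign picked up when theta_i theta_j is put in increasing order. *)
Definition tsgn (i j : I) : rat := if i == j then 0 else if (j < i)%O then -1 else 1.

Definition msign a b : rat :=
  \prod_(i <- tsupp a) \prod_(j <- tsupp b) tsgn i j.

Lemma mmulE a b i : mmul a b i = ((a i).1 || (b i).1, ((a i).2 + (b i).2)%N).
Proof.
rewrite fsfunE inE; case: ifP => // /negbT; rewrite negb_or => /andP[ha hb].
by rewrite !fsfun_dflt.
Qed.

Lemma mono1E i : mono1 i = (false, 0%N). Proof. by rewrite fsfunE. Qed.

Lemma mmulA : associative mmul.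
Proof.
by move=> a b c; apply/fsfunP => i; rewrite !mmulE /= orbA addnA.
Qed.

Lemma mmul1m : left_id mono1 mmul.
Proof. by move=> a; apply/fsfunP => i; rewrite mmulE mono1E /= -surjective_pairing. Qed.

Lemma mmulm1 : right_id mono1 mmul.
Proof.
by move=> a; apply/fsfunP => i; rewrite mmulE mono1E /= orbF addn0 -surjective_pairing.
Qed.

Lemma in_tsupp m i : (i \in tsupp m) = (m i).1.
Proof.
rewrite !inE /= andb_idl //; apply: contraTT => /fsfun_dflt -> //.
Qed.

Lemma tsupp_mul a b : tsupp (mmul a b) = (tsupp a `|` tsupp b)%fset.
Proof. by apply/fsetP => i; rewrite inE !in_tsupp mmulE. Qed.

Lemma tsupp1 : tsupp mono1 = fset0%fset.
Proof. by apply/fsetP => i; rewrite in_tsupp mono1E inE. Qed.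

Lemma finite_factors m : finite_set [set p | mmul p.1 p.2 = m].
Proof.
pose N := \max_(i : finsupp m) (m (val i)).2.
pose mk (g : {ffun finsupp m -> bool * 'I_N.+1}) : mono I :=
  [fsfun i : finsupp m => ((g i).1, val (g i).2)].
have fin : finite_set (range mk).
  by apply: finite_image; apply: finite_finset.
apply: (sub_finite_set _ (finite_setX fin fin)) => -[a b] /= abm.
have key c : (forall i, ((c i).1 ==> (m i).1) /\ (c i).2 <= (m i).2)%N -> range mk c.
  move=> cm.
  exists [ffun i : finsupp m => ((c (val i)).1, inord (c (val i)).2)] => //.
  apply/fsfunP => i; rewrite fsfun_ffun; case: insubP => [u _ <-|im] /=.
    rewrite ffunE /= inordK -?surjective_pairing //.
    rewrite ltnS (leq_trans (cm _).2) //.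
    by rewrite /N (leq_bigmax (F := fun i : finsupp m => (m (val i)).2)).
  have := cm i; rewrite (fsfun_dflt im) implybF leqn0 => -[+ /eqP].
  by case: (c i) => -[] ? //= _ ->.
split; apply: key => i; rewrite -abm mmulE /=.
  by case: (a i).1; rewrite leq_addr.
by case: (b i).1; rewrite ?orbT leq_addl.
Qed.

Lemma fdisjointNP (A B : {fset I}) :
  ~~ [disjoint A & B]%fset -> exists2 i, i \in A & i \in B.
Proof.
by rewrite /fdisjoint => /fset0Pn[i]; rewrite inE => /andP[iA iB]; exists i.
Qed.

Lemma prod_fsetU (R : comPzRingType) (A B : {fset I}) (F : I -> R) : [disjoint A & B]%fset ->
  \prod_(i <- (A `|` B)%fset) F i = (\prod_(i <- A) F i) * \prod_(i <- B) F i.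
Proof.
move=> dAB; rewrite -big_cat; apply: perm_big; apply: uniq_perm => //.
  rewrite cat_uniq !fset_uniq /= andbT; apply/hasPn => i iB.
  by apply/negP => iA; move/fdisjointP: dAB => /(_ _ iA); rewrite iB.
by move=> i; rewrite mem_cat inE.
Qed.

Lemma msign_dis a b : ~~ [disjoint tsupp a & tsupp b]%fset -> msign a b = 0.
Proof.
case/fdisjointNP => i ia ib.
apply/eqP; rewrite prodf_seq_eq0; apply/hasP; exists i => //=.
by rewrite prodf_seq_eq0; apply/hasP; exists i => //=; rewrite /tsgn eqxx.
Qed.

Lemma msign_cocycle a b c :
  msign b c * msign a (mmul b c) = msign a b * msign (mmul a b) c.
Proof.
have [dbc|nbc] := boolP [disjoint tsupp b & tsupp c]%fset; last first.
  rewrite msign_dis // mul0r.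
  suff -> : msign (mmul a b) c = 0 by rewrite mulr0.
  apply: msign_dis; apply: contra nbc; rewrite tsupp_mul => /fdisjointP h.
  by apply/fdisjointP => i ib; apply: h; rewrite inE ib orbT.
have [dab|nab] := boolP [disjoint tsupp a & tsupp b]%fset; last first.
  rewrite (msign_dis nab) mul0r.
  suff -> : msign a (mmul b c) = 0 by rewrite mulr0.
  apply: msign_dis; apply: contra nab; rewrite tsupp_mul => /fdisjointP h.
  by apply/fdisjointP => i /h; rewrite inE negb_or => /andP[].
rewrite [msign a (mmul b c)]/msign [msign (mmul a b) c]/msign !tsupp_mul.
rewrite (prod_fsetU _ dab).
under [X in _ * X = _]eq_bigr do rewrite (prod_fsetU _ dbc).
rewrite big_split /= -/(msign a b) -/(msign a c) -/(msign b c).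
by rewrite mulrCA (mulrC (msign b c)).
Qed.

Lemma msign1m a : msign mono1 a = 1.
Proof. by rewrite /msign tsupp1 big_seq_fset0. Qed.

Lemma msignm1 a : msign a mono1 = 1.
Proof. by rewrite /msign tsupp1 big1 // => i _; rewrite big_seq_fset0. Qed.

End Monomials.

Arguments mono1 {d I}.

Definition series d (I : orderType d) := mono I -> rat^o.
HB.instance Definition _ d (I : orderType d) := GRing.Lmodule.copy (series I) (mono I -> rat^o).

Section FsBig.
Variables (R : pzRingType) (T U : choiceType).
Implicit Types (P : set T) (Q : T -> set U).

Lemma dep_pair_fsbig P Q (F : T -> U -> R) :
  finite_set P -> (forall p, P p -> finite_set (Q p)) ->
  \sum_(p \in P) \sum_(q \in Q p) F p q =
  \sum_(x \in [set x | P x.1 /\ Q x.1 x.2]) F x.1 x.2.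
Proof.
move=> fP fQ; pose V := \bigcup_(p in P) Q p.
have fV : finite_set V by exact: bigcup_finite.
transitivity (\sum_(p \in P) \sum_(q \in V) if q \in Q p then F p q else 0).
  apply: eq_fsbigr => p /set_mem Pp.
  rewrite fsbig_mkcond [RHS]fsbig_mkcond; apply: eq_fsbigr => q _.
  rewrite /patch; case: ifP => [/set_mem Qq|_]; last by case: ifP.
  by rewrite mem_set //; exists p.
rewrite pair_fsbig // fsbig_mkcond [RHS]fsbig_mkcond.
apply: eq_fsbigr => -[p q] _; rewrite /patch /=.
have [/set_mem/=[Pp Vq]|/negP nPV] := boolP ((p, q) \in P `*` V).
  have [/set_mem/= Qq|/negP nQ] := boolP (q \in Q p).
    by rewrite mem_set.
  by case: ifP => // /set_mem/= [_ Qq]; case: nQ; exact/mem_set.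
case: ifP => // /set_mem/= [Pp Qq]; case: nPV; apply/mem_set; split=> //.
by exists p.
Qed.

End FsBig.

Section Series.
Context {d : Order.disp_t} {I : orderType d}.
Implicit Types (f g h : series I) (m : mono I).

(* Product of power series. The sum is finite by finite_factors. *)
Definition smul f g : series I := fun m =>
  \sum_(p \in [set p | mmul p.1 p.2 = m]) msign p.1 p.2 * (f p.1 * g p.2).

Definition sone : series I := fun m => (m == mono1)%:R.

Lemma smulA : associative smul.
Proof.
move=> f g h; apply/funext => m.
rewrite /smul.
transitivity (\sum_(x \in [set x : (mono I * mono I) * (mono I * mono I) |
    mmul x.1.1 x.1.2 = m /\ mmul x.2.1 x.2.2 = x.1.2])
  (msign x.1.1 x.1.2 * msign x.2.1 x.2.2 * (f x.1.1 * g x.2.1 * h x.2.2))).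
  apply: etrans; last first.
    exact: (@dep_pair_fsbig _ _ _ [set p | mmul p.1 p.2 = m]
      (fun p => [set q | mmul q.1 q.2 = p.2])
      (fun p q => msign p.1 p.2 * msign q.1 q.2 * (f p.1 * g q.1 * h q.2))
      (finite_factors m) (fun p _ => finite_factors p.2)).
  apply: eq_fsbigr => -[a n] _ /=.
  rewrite !mulr_fsumr; apply: eq_fsbigr => -[b c] _ /=.
  by rewrite !mulrA; congr (_ * _ * _); rewrite mulrAC.
transitivity (\sum_(x \in [set x : (mono I * mono I) * (mono I * mono I) |
    mmul x.1.1 x.1.2 = m /\ mmul x.2.1 x.2.2 = x.1.1])
  (msign x.1.1 x.1.2 * msign x.2.1 x.2.2 * (f x.2.1 * g x.2.2 * h x.1.2))); last first.
  apply: esym; apply: etrans; last first.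
    exact: (@dep_pair_fsbig _ _ _ [set p | mmul p.1 p.2 = m]
      (fun p => [set q | mmul q.1 q.2 = p.1])
      (fun p q => msign p.1 p.2 * msign q.1 q.2 * (f q.1 * g q.2 * h p.2))
      (finite_factors m) (fun p _ => finite_factors p.1)).
  apply: eq_fsbigr => -[n c] _ /=.
  rewrite mulr_fsuml mulr_fsumr; apply: eq_fsbigr => -[a b] _ /=.
  by rewrite !mulrA.
pose r (x : (mono I * mono I) * (mono I * mono I)) :=
  ((x.2.1, mmul x.2.2 x.1.2), (x.2.2, x.1.2)).
rewrite (reindex_fsbig r [set x : (mono I * mono I) * (mono I * mono I) |
    mmul x.1.1 x.1.2 = m /\ mmul x.2.1 x.2.2 = x.1.1]).
  apply: eq_fsbigr => -[[n c] [a b]] /set_mem/= [_ <-].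
  by rewrite [X in X * _]mulrC msign_cocycle [X in X * _]mulrC.
split.
- by move=> [[n c] [a b]] /= [<- <-]; rewrite mmulA.
- move=> [[n c] [a b]] [[n' c'] [a' b']] /set_mem/= [_ <-] /set_mem/= [_ <-].
  by move=> [-> _ -> ->].
- move=> [[a n] [b c]] /= [<- <-]; exists ((mmul a b, c), (a, b)) => //=.
  by rewrite mmulA.
Qed.

Lemma smul1f : left_id sone smul.
Proof.
move=> f; apply/funext => m; rewrite /smul.
rewrite -(fsbig_widen [set (mono1, m)]).
- by rewrite fsbig_set1 /= msign1m /sone eqxx !mul1r.
- by move=> _ ->; rewrite /= mmul1m.
- move=> [a b] /= [abm]; rewrite /sone; case: eqP => [a1|_]; last first.
    by rewrite mul0r mulr0.
  by move=> [] ; rewrite -abm a1 mmul1m.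
Qed.

Lemma smulf1 : right_id sone smul.
Proof.
move=> f; apply/funext => m; rewrite /smul.
rewrite -(fsbig_widen [set (m, mono1)]).
- by rewrite fsbig_set1 /= msignm1 /sone eqxx !mulr1 mul1r.
- by move=> _ ->; rewrite /= mmulm1.
- move=> [a b] /= [abm]; rewrite /sone; case: eqP => [a1|_]; last first.
    by rewrite !mulr0.
  by move=> [] ; rewrite -abm a1 mmulm1.
Qed.

Lemma smulDl : left_distributive smul +%R.
Proof.
move=> f g h; apply/funext => m; rewrite /smul.
rewrite -[RHS]fsbig_split; last exact: finite_factors.
by apply: eq_fsbigr => p _ /=; rewrite -mulrDr -mulrDl.
Qed.

Lemma smulDr : right_distributive smul +%R.
Proof.
move=> f g h; apply/funext => m; rewrite /smul.
rewrite -[RHS]fsbig_split; last exact: finite_factors.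
by apply: eq_fsbigr => p _ /=; rewrite -!mulrDr.
Qed.

Lemma sone_neq0 : sone != 0.
Proof.
by apply/eqP => /(congr1 (fun f => f mono1)); rewrite /sone eqxx.
Qed.

HB.instance Definition _ := GRing.Zmodule_isNzRing.Build (series I)
  smulA smul1f smulf1 smulDl smulDr sone_neq0.

Lemma smulZl (k : rat) f g : k *: (f * g) = (k *: f) * g.
Proof.
apply/funext => m; rewrite /GRing.mul /= /smul [LHS]mulr_fsumr.
by apply: eq_fsbigr => p _; rewrite mulrCA -mulrA.
Qed.

HB.instance Definition _ := GRing.LSemiModule_isLSemiAlgebra.Build rat (series I) smulZl.

Lemma smulZr (k : rat) f g : k *: (f * g) = f * (k *: g).
Proof.
apply/funext => m; rewrite /GRing.mul /= /smul [LHS]mulr_fsumr.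
by apply: eq_fsbigr => p _; rewrite mulrCA [X in _ * X]mulrCA.
Qed.

HB.instance Definition _ := GRing.Lalgebra_isAlgebra.Build rat (series I) smulZr.

End Series.

Section Degrees.
Context {d : Order.disp_t} {I : orderType d}.

Definition xdeg (m : mono I) : nat := \sum_(i <- finsupp m) (m i).2.

Definition tdeg (m : mono I) : nat := \sum_(i <- finsupp m) (m i).1.

(* The degree counts the thetas: a bound on the degree in x alone would allow the
   sum of all theta_(i_1) ... theta_(i_k), i_1 < ... < i_k, k >= 0, which is not a
   finite sum of homogeneous series. *)
Definition bounded_degree (f : series I) : Prop :=
  exists N : nat, forall m, f m != 0 -> (xdeg m + tdeg m <= N)%N.

Lemma deg_sumE (m : mono I) (S : {fset I}) : (finsupp m `<=` S)%fset ->
  (xdeg m + tdeg m = \sum_(i <- S) ((m i).2 + (m i).1))%N.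
Proof.
move=> mS; rewrite /xdeg /tdeg -big_split /=.
by apply: big_fset_incl => // i _ /fsfun_dflt ->.
Qed.

Lemma bounded_lin k (f g : series I) :
  bounded_degree f -> bounded_degree g -> bounded_degree (k *: f + g).
Proof.
move=> [M fM] [N gN]; exists (maxn M N) => m fgm.
rewrite leq_max; have [f0|/fM ->//] := eqVneq (f m) 0.
have [g0|/gN ->//] := eqVneq (g m) 0; last by rewrite orbT.
by move: fgm; rewrite [X in X != _](_ : _ = k * f m + g m) // f0 g0 mulr0 addr0 eqxx.
Qed.

Lemma bounded_one : bounded_degree (1 : series I).
Proof.
exists 0%N => m m1; have -> : m = mono1.
  by apply/eqP; apply: contraNT m1 => /negbTE m1; rewrite /GRing.one /= /sone m1.
by rewrite (@deg_sumE _ fset0) ?big_seq_fset0 // finsupp0.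
Qed.

Lemma smulE (f g : series I) m :
  (f * g) m = \sum_(p \in [set p | mmul p.1 p.2 = m]) msign p.1 p.2 * (f p.1 * g p.2).
Proof. by []. Qed.

Lemma finsupp_mmull (a b : mono I) : (finsupp a `<=` finsupp (mmul a b))%fset.
Proof.
apply/fsubsetP => i; rewrite !mem_finsupp mmulE.
by case: (a i) => -[] [|n] //=; rewrite xpair_eqE ?orbF ?andbF.
Qed.

Lemma finsupp_mmulr (a b : mono I) : (finsupp b `<=` finsupp (mmul a b))%fset.
Proof.
apply/fsubsetP => i; rewrite !mem_finsupp mmulE.
by case: (b i) => -[] [|n] //=; rewrite xpair_eqE ?orbT ?andbF ?addnS ?andbF.
Qed.

Lemma bounded_mul (f g : series I) :
  bounded_degree f -> bounded_degree g -> bounded_degree (f * g).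
Proof.
move=> [M fM] [N gN]; exists (M + N)%N => m fgm; apply: contraNT fgm => degm.
apply/eqP; rewrite smulE fsbig1 // => -[a b] /= abm.
have [->|/fM ha] := eqVneq (f a) 0; first by rewrite mul0r mulr0.
have [->|/gN hb] := eqVneq (g b) 0; first by rewrite !mulr0.
case/negP: degm; apply: leq_trans (leq_add ha hb).
rewrite -abm (deg_sumE (fsubset_refl _)) (deg_sumE (finsupp_mmull a b)).
rewrite (deg_sumE (finsupp_mmulr a b)) -big_split /=; apply: leq_sum => i _.
rewrite mmulE /= addnACA leq_add2l.
by case: (a i).1; case: (b i).1.
Qed.

End Degrees.

Section Push.
Context {d d' : Order.disp_t} {I : orderType d} {J : orderType d'}.
Implicit Types (e : I -> J) (m a b : mono I).

(* The monomial obtained from m by the substitution i -> e i, without the sign;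
   only meaningful when e is injective on the support of m. *)
Definition push e m : mono J :=
  [fsfun j in [fset e i | i in finsupp m]%fset =>
     if [seq i <- finsupp m | e i == j] is i :: _ then m i else (false, 0%N)].

Lemma pushE (D : {fset I}) e m i : {in D &, injective e} ->
  (finsupp m `<=` D)%fset -> i \in D -> push e m (e i) = m i.
Proof.
move=> einj /fsubsetP mD iD; rewrite fsfunE.
have key k : k \in finsupp m -> e k = e i -> k = i.
  by move=> km /einj -> //; apply: mD.
case: imfsetP => [[/= k km eik]|nim].
  case E : [seq _ <- _ | _] => [|k' s].
    have : k \in [::] by rewrite -E mem_filter eik eqxx km.
    by [].
  have : k' \in k' :: s by rewrite inE eqxx.
  by rewrite -E mem_filter => /andP[/eqP ek' k'm]; rewrite (key k').
apply/esym/fsfun_dflt; apply/negP => im; apply: nim.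
by exists i.
Qed.

Lemma pushN e m j : (forall i, i \in finsupp m -> e i <> j) ->
  push e m j = (false, 0%N).
Proof.
by move=> h; rewrite fsfunE; case: imfsetP => // -[/= i im /esym/h].
Qed.

Lemma push_uniq e m (m' : mono J) : {in finsupp m &, injective e} ->
  (forall i, i \in finsupp m -> m' (e i) = m i) ->
  (forall j, j \in finsupp m' -> exists2 i, i \in finsupp m & e i = j) ->
  m' = push e m.
Proof.
move=> einj h1 h2; apply/fsfunP => j.
have [[i im <-]|nj] := pselect (exists2 i, i \in finsupp m & e i = j).
  by rewrite (pushE einj) // h1.
rewrite pushN; last by move=> i im eij; apply: nj; exists i.
by apply: fsfun_dflt; apply/negP => /h2.
Qed.

Lemma finsupp_push e m : {in finsupp m &, injective e} ->
  finsupp (push e m) = [fset e i | i in finsupp m]%fset.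
Proof.
move=> einj; apply/fsetP => j; apply/idP/imfsetP => [|[/= i im ->]].
  apply: contraTP => nj; rewrite mem_finsupp negbK pushN // => i im eij.
  by apply: nj; exists i.
by rewrite mem_finsupp (pushE einj) // -mem_finsupp.
Qed.

Lemma tsupp_push e m : {in finsupp m &, injective e} ->
  tsupp (push e m) = [fset e i | i in tsupp m]%fset.
Proof.
move=> einj; apply/fsetP => j; rewrite in_tsupp.
apply/idP/imfsetP => [jm|[/= i]]; last first.
  by rewrite inE /= => /andP[im mi] ->; rewrite (pushE einj).
have : j \in finsupp (push e m) by apply: contraTT jm => /fsfun_dflt ->.
rewrite finsupp_push // => /imfsetP[/= i im ji]; exists i => //=.
by move: jm; rewrite ji (pushE einj) // in_tsupp.
Qed.

Lemma deg_push e m : {in finsupp m &, injective e} ->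
  (xdeg (push e m) + tdeg (push e m) = xdeg m + tdeg m)%N.
Proof.
move=> einj; rewrite !(deg_sumE (fsubset_refl _)) finsupp_push //.
rewrite big_imfset //=; apply: eq_big_seq => i im.
by rewrite (pushE einj).
Qed.

Lemma eq_push e e' m : {in finsupp m &, injective e} -> {in finsupp m, e =1 e'} ->
  push e m = push e' m.
Proof.
move=> einj ee'; apply: push_uniq => [i j im jm|i im|j].
- by rewrite -!ee' //; apply: einj.
- by rewrite -ee' // (pushE einj).
- by rewrite finsupp_push // => /imfsetP[/= i im ->]; exists i; rewrite ?ee'.
Qed.

Lemma push1 e : push e mono1 = mono1.
Proof. by apply/fsfunP => j; rewrite pushN ?mono1E // => i; rewrite in_finsupp0. Qed.

Lemma push_eq1 e m : {in finsupp m &, injective e} -> (push e m == mono1) = (m == mono1).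
Proof.
move=> einj; apply/eqP/eqP => [p1|->]; last by rewrite push1.
apply/fsfunP => i; rewrite mono1E.
have [im|/fsfun_dflt //] := boolP (i \in finsupp m).
by rewrite -(pushE einj) // p1 mono1E.
Qed.

Lemma push_mmul e a b : {in finsupp (mmul a b) &, injective e} ->
  mmul (push e a) (push e b) = push e (mmul a b).
Proof.
move=> einj; have [sa sb] := (finsupp_mmull a b, finsupp_mmulr a b).
have inja : {in finsupp a &, injective e}.
  by move=> i j /(fsubsetP sa) + /(fsubsetP sa); apply: einj.
have injb : {in finsupp b &, injective e}.
  by move=> i j /(fsubsetP sb) + /(fsubsetP sb); apply: einj.
apply: push_uniq => // [i im|j].
  by rewrite !mmulE !(pushE einj).
rewrite mem_finsupp mmulE => h.
have : (j \in finsupp (push e a)) || (j \in finsupp (push e b)).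
  apply: contraNT h; rewrite negb_or => /andP[ja jb].
  by rewrite !fsfun_dflt.
rewrite !finsupp_push // => /orP[] /imfsetP[/= i im ->]; exists i => //.
  exact: (fsubsetP sa).
exact: (fsubsetP sb).
Qed.

Lemma mul_push (f g : series J) e m : {in finsupp m &, injective e} ->
  (f * g) (push e m) = \sum_(p \in [set p | mmul p.1 p.2 = m])
    msign (push e p.1) (push e p.2) * (f (push e p.1) * g (push e p.2)).
Proof.
move=> einj; rewrite smulE.
rewrite (reindex_fsbig (fun p => (push e p.1, push e p.2)) [set p | mmul p.1 p.2 = m]) //.
have sub a b : mmul a b = m -> (finsupp a `<=` finsupp m)%fset * (finsupp b `<=` finsupp m)%fset.
  by move=> <-; split; [exact: finsupp_mmull | exact: finsupp_mmulr].
have inj (a a' : mono I) : (finsupp a `<=` finsupp m)%fset ->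
    (finsupp a' `<=` finsupp m)%fset -> push e a = push e a' -> a = a'.
  move=> am a'm aa'; apply/fsfunP => i.
  have [im|im] := boolP (i \in finsupp m).
    by rewrite -(pushE einj am) // aa' (pushE einj a'm).
  by rewrite !fsfun_dflt //; apply: contra im; apply/fsubsetP.
split.
- by move=> [a b] /= abm; rewrite push_mmul abm.
- move=> [a b] [a' b'] /set_mem /= /sub[? ?] /set_mem/= /sub[? ?] [? ?].
  by congr (_, _); apply: inj.
- move=> [a' b'] /= abm.
  pose bk (c : mono J) : mono I := [fsfun i in finsupp m => c (e i)].
  have sbk c : (finsupp (bk c) `<=` finsupp m)%fset by exact: finsupp_sub.
  have bkE (c : mono J) : (finsupp c `<=` finsupp (push e m))%fset -> push e (bk c) = c.
    move=> cm; apply/esym/push_uniq => [i j|i|j].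
    - by move=> /(fsubsetP (sbk c)) + /(fsubsetP (sbk c)); apply: einj.
    - by move=> /(fsubsetP (sbk c)) im; rewrite fsfunE im.
    - move=> jc; have := fsubsetP cm _ jc.
      rewrite finsupp_push // => /imfsetP[/= i im ji]; exists i => //.
      by rewrite mem_finsupp fsfunE im -ji -mem_finsupp.
  have pa : push e (bk a') = a' by apply: bkE; rewrite -abm finsupp_mmull.
  have pb : push e (bk b') = b' by apply: bkE; rewrite -abm finsupp_mmulr.
  exists (bk a', bk b') => /=; last by rewrite pa pb.
  apply/fsfunP => i; rewrite mmulE !fsfunE.
  case: ifPn => [im|/fsfun_dflt-> //].
  by rewrite -(pushE einj (fsubset_refl _) im) -abm mmulE.
Qed.

(* The sign relating prod theta_(e i) (i increasing in the theta-support of m) to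
   the same product written in increasing order. *)
Definition nsgn e m : rat :=
  \prod_(i <- tsupp m) \prod_(j <- tsupp m | (i < j)%O)
    (if (e j < e i)%O then -1 else 1).

Lemma nsgn1 e : nsgn e mono1 = 1.
Proof. by rewrite /nsgn tsupp1 big_seq_fset0. Qed.

Lemma eq_nsgn e e' m : {in finsupp m, e =1 e'} -> nsgn e m = nsgn e' m.
Proof.
move=> ee'; rewrite /nsgn; apply: eq_big_seq => i; rewrite inE => /andP[im _].
rewrite big_seq_cond [RHS]big_seq_cond; apply: eq_bigr => j /andP[+ _].
by rewrite inE => /andP[jm _]; rewrite !ee'.
Qed.

Lemma nsgn_mono e m : {in finsupp m &, {homo e : i j / (i < j)%O}} -> nsgn e m = 1.
Proof.
move=> eh; rewrite /nsgn big_seq big1 // => i; rewrite inE => /andP[im _].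
rewrite big_seq_cond big1 // => j /andP[]; rewrite inE => /andP[jm _] ij.
by rewrite (lt_gtF (eh _ _ im jm ij)).
Qed.

Lemma nsgn_mul e a b : {in finsupp (mmul a b) &, injective e} ->
  msign (push e a) (push e b) * (nsgn e a * nsgn e b) = nsgn e (mmul a b) * msign a b.
Proof.
move=> einj; have [sa sb] := (finsupp_mmull a b, finsupp_mmulr a b).
have inja : {in finsupp a &, injective e}.
  by move=> i j /(fsubsetP sa) + /(fsubsetP sa); apply: einj.
have injb : {in finsupp b &, injective e}.
  by move=> i j /(fsubsetP sb) + /(fsubsetP sb); apply: einj.
have st (m : mono I) : {subset tsupp m <= finsupp m} by move=> i; rewrite inE => /andP[].
have [dab|nab] := boolP [disjoint tsupp a & tsupp b]%fset; last first.
  rewrite (msign_dis nab) mulr0 msign_dis ?mul0r //.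
  apply: contra nab; rewrite !tsupp_push // => /fdisjointP h.
  apply/fdisjointP => i ia; have : e i \in [fset e i | i in tsupp a]%fset by apply/imfsetP; exists i.
  by move=> /h; apply: contra => ib; apply/imfsetP; exists i.
pose c i j : rat := if (i < j)%O && (e j < e i)%O then -1 else 1.
have nE m : nsgn e m = \prod_(i <- tsupp m) \prod_(j <- tsupp m) c i j.
  by apply: eq_bigr => i _; rewrite big_mkcond; apply: eq_bigr => j _; rewrite /c; case: ifP.
rewrite !nE tsupp_mul (prod_fsetU _ dab).
under [X in _ = X * _ * _]eq_bigr do rewrite (prod_fsetU _ dab).
under [X in _ = _ * X * _]eq_bigr do rewrite (prod_fsetU _ dab).
rewrite !big_split /= [X in _ = _ * (X * _) * _]exchange_big /=.
set A := (X in _ * (X * _) = _); set B := (X in _ * (_ * X) = _).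
set X := (X in _ = _ * X * _ * _); set Y := (X in _ = _ * (X * _) * _).
suff -> : msign (push e a) (push e b) = X * Y * msign a b.
  rewrite [LHS]mulrC -!mulrA; congr (_ * _).
  by rewrite mulrCA; congr (_ * _); rewrite mulrCA.
rewrite /X /Y /msign !tsupp_push // big_imfset /=; last first.
  by move=> i j /st ? /st ?; apply: inja.
rewrite -!big_split /=; apply: eq_big_seq => i ia.
rewrite big_imfset /=; last by move=> k l /st ? /st ?; apply: injb.
rewrite -!big_split /=; apply: eq_big_seq => j jb.
have nij : i != j by apply: contraTneq ia => ->; apply: contraTN jb => /(fdisjointP dab).
have neij : e i != e j.
  apply: contra nij => /eqP /einj -> //; first by apply/(fsubsetP sa)/st.
  by apply/(fsubsetP sb)/st.
rewrite /c /tsgn (negbTE nij) (negbTE neij).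
have [ij|ji|ij] := ltgtP i j; last by rewrite ij eqxx in nij.
  have [eij|eji|eij] := ltgtP (e i) (e j); last by rewrite eij eqxx in neij.
    by rewrite /= !mul1r.
  by rewrite /= !mulr1.
have [eij|eji|eij] := ltgtP (e i) (e j); last by rewrite eij eqxx in neij.
  by rewrite /= mul1r mulN1r opprK.
by rewrite /= !mul1r.
Qed.

End Push.

Lemma subset_inj (T1 T2 : choiceType) (e : T1 -> T2) (A B : {fset T1}) :
  (A `<=` B)%fset -> {in B &, injective e} -> {in A &, injective e}.
Proof. by move=> /fsubsetP AB einj i j /AB + /AB; apply: einj. Qed.

(* n successive countable sets of variables: (k, i) is the i-th variable of the
   k-th set, and each set precedes the next ones. *)
Definition vars (n : nat) := ('I_n *l nat)%type.

Section Vars.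
Variable n : nat.
Implicit Types (m : mono (vars n)) (e : vars n -> vars n).

Definition msupp m : seq (vars n) := sort <=%O (finsupp m).

(* The dotted composition of m, a part (true, a) being the dotted a. *)
Definition comp m : seq (bool * nat) := [seq m v | v <- msupp m].

(* The dotted composition of the part of m in the k-th set of variables. *)
Definition bcomp (k : 'I_n) m : seq (bool * nat) :=
  [seq m v | v : vars n <- msupp m & v.1 == k].

(* Quasisymmetry in each of the n sets of variables separately. *)
Definition quasisymmetric (f : series (vars n)) : Prop :=
  forall m m', (forall k, bcomp k m = bcomp k m') -> f m = f m'.

(* Invariance under simultaneous permutations e of the x's and the thetas inside
   each set of variables: the substitution maps the monomial m to nsgn e m times
   the monomial m' with m' (e v) = m v. *)
Definition symmetric_series (f : series (vars n)) : Prop :=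
  forall e : vars n -> vars n, bijective e -> (forall v, (e v).1 = v.1) ->
  forall m m', (forall v, m' (e v) = m v) -> f m' = nsgn e m * f m.

Definition block e m := {in finsupp m, forall v, (e v).1 = v.1}.

Definition increasing_on e m := {in finsupp m &, {homo e : v w / (v < w)%O}}.

Lemma mem_msupp m : msupp m =i finsupp m.
Proof. by move=> v; rewrite mem_sort. Qed.

Lemma msupp_uniq m : uniq (msupp m).
Proof. by rewrite sort_uniq fset_uniq. Qed.

Lemma msupp_lt m : sorted <%O (msupp m).
Proof. by rewrite lt_sorted_uniq_le msupp_uniq sort_le_sorted. Qed.

End Vars.

Lemma incr_inj (d d' : Order.disp_t) (T1 : orderType d) (T2 : orderType d') (e : T1 -> T2) (A : {fset T1}) :
  {in A &, {homo e : v w / (v < w)%O}} -> {in A &, injective e}.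
Proof.
move=> eh v w vA wA evw; have [vw|wv|//] := ltgtP v w.
  by have := eh _ _ vA wA vw; rewrite evw ltxx.
by have := eh _ _ wA vA wv; rewrite evw ltxx.
Qed.

Lemma msupp_push n p (e : vars n -> vars p) m :
  {in finsupp m &, {homo e : v w / (v < w)%O}} ->
  msupp (push e m) = map e (msupp m).
Proof.
move=> eh; have einj := incr_inj eh.
apply: (irr_sorted_eq lt_trans ltxx); first exact: msupp_lt.
  apply: (homo_sorted_in (P := mem (finsupp m)) (e := <%O)) (msupp_lt m) => //.
  by apply/allP => v; rewrite mem_msupp.
move=> w; rewrite mem_msupp finsupp_push //; apply/imfsetP/mapP => -[v /= vm ->].
  by exists v; rewrite ?mem_msupp.
by exists v; rewrite -?mem_msupp.
Qed.

Lemma ordEfun n m m' : (forall k : 'I_n, bcomp k m = bcomp k m') ->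
  exists e : vars n -> vars n, [/\ block e m, increasing_on e m & m' = push e m].
Proof.
move=> mm'.
pose s (m : mono (vars n)) k : seq (vars n) := [seq v : vars n <- msupp m | v.1 == k].
have ss k : size (s m k) = size (s m' k).
  by have /(congr1 size) := mm' k; rewrite !size_map.
have ls (m0 : mono (vars n)) k : sorted <%O (s m0 k).
  by apply: sorted_filter (msupp_lt m0); exact: lt_trans.
have in_s (m0 : mono (vars n)) k v : (v \in s m0 k) = (v.1 == k) && (v \in finsupp m0).
  by rewrite mem_filter mem_msupp.
pose e (v : vars n) : vars n := nth v (s m' v.1) (index v (s m v.1)).
have idx v : v \in finsupp m -> (index v (s m v.1) < size (s m' v.1))%N.
  by move=> vm; rewrite -ss index_mem in_s eqxx.
have es v : v \in finsupp m -> e v \in s m' v.1.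
  by move=> vm; rewrite mem_nth // idx.
have eb : block e m by move=> v /es; rewrite in_s => /andP[/eqP].
have ei : increasing_on e m.
  move=> v w vm wm vw.
  have [vwE|vwN] := eqVneq v.1 w.1; last first.
    have : (v.1 < w.1)%O.
      rewrite lt_neqAle vwN; move: vw; rewrite ltEprodlexi => /andP[]//.
    by rewrite ltEprodlexi !eb // => h; rewrite (ltW h) leNgt h.
  rewrite /e (set_nth_default v w) ?idx // vwE.
  have vi : v \in s m w.1 by rewrite in_s vwE eqxx.
  have wi : w \in s m w.1 by rewrite in_s eqxx.
  apply: (sorted_ltn_nth lt_trans v (ls m' w.1)); rewrite ?inE -?ss ?index_mem //.
  rewrite ltnNge; apply/negP; rewrite leq_eqVlt => /orP[/eqP|].
    by move/(congr1 (nth v (s m w.1))); rewrite !nth_index // => wv; rewrite wv ltxx in vw.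
  move=> /(sorted_ltn_nth lt_trans v (ls m w.1)).
  rewrite !inE !index_mem !nth_index // => /(_ wi vi) wv.
  by rewrite (lt_gtF vw) in wv.
exists e; split => //; apply: push_uniq; first exact: incr_inj.
  move=> v vm; rewrite /e -(nth_map _ (false, 0%N)) ?idx //.
  have := mm' v.1; rewrite /bcomp -/(s m v.1) -/(s m' v.1) => <-.
  by rewrite (nth_map v) ?ss ?idx // nth_index // in_s eqxx.
move=> w wm'.
pose v := nth w (s m w.1) (index w (s m' w.1)).
have iw : (index w (s m' w.1) < size (s m w.1))%N by rewrite ss index_mem in_s eqxx.
have : v \in s m w.1 by rewrite mem_nth.
rewrite in_s => /andP[/eqP vw vm]; exists v => //.
rewrite /e vw index_uniq //; last exact: lt_sorted_uniq.
by rewrite nth_index // in_s eqxx.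
Qed.

Lemma bcomp_push n (e : vars n -> vars n) m k : block e m -> increasing_on e m ->
  bcomp k (push e m) = bcomp k m.
Proof.
move=> eb ei; rewrite /bcomp msupp_push // filter_map -map_comp.
have -> : [seq v <- msupp m | preim e (fun v => v.1 == k) v] =
          [seq v <- msupp m | v.1 == k].
  by apply: eq_in_filter => v; rewrite mem_msupp => vm /=; rewrite eb.
apply/eq_in_map => v; rewrite mem_filter mem_msupp => /andP[_ vm] /=.
by rewrite (pushE (incr_inj ei)).
Qed.

Lemma quasisymmetricP n (f : series (vars n)) : quasisymmetric f <->
  (forall m e, block e m -> increasing_on e m -> f (push e m) = f m).
Proof.
split=> [fq m e eb ei|fq m m' /ordEfun[e [eb ei ->]]]; last by rewrite fq.
by apply: fq => k; exact: bcomp_push.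
Qed.

Lemma extend_inj (s t : seq nat) : uniq s -> uniq t -> size s = size t ->
  exists2 h : nat -> nat, bijective h & map h s = t.
Proof.
move=> us ut st.
have [N ltN] : exists N, forall x, x \in s ++ t -> (x < N)%N.
  by exists (\max_(x <- s ++ t) x).+1 => x xst; rewrite ltnS leq_bigmax_seq.
pose c u := u ++ [seq x <- iota 0 N | x \notin u].
have inc u : {subset u <= s ++ t} -> c u =i iota 0 N.
  move=> ust x; rewrite mem_cat mem_filter mem_iota add0n leq0n.
  by case: (boolP (x \in u)) => //= /ust /ltN ->.
have uc u : uniq u -> uniq (c u).
  move=> uu; rewrite cat_uniq uu filter_uniq ?iota_uniq // andbT.
  by apply/hasPn => x; rewrite mem_filter => /andP[].
have sS : {subset s <= s ++ t} by move=> x xs; rewrite mem_cat xs.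
have tS : {subset t <= s ++ t} by move=> x xs; rewrite mem_cat xs orbT.
have sc u : uniq u -> {subset u <= s ++ t} -> size (c u) = N.
  move=> uu uS; rewrite -[RHS](size_iota 0); apply: perm_size.
  by apply: uniq_perm; [exact: uc | exact: iota_uniq | exact: inc].
pose h u v x := nth x (c v) (index x (c u)).
have hK u v : uniq u -> {subset u <= s ++ t} -> uniq v -> {subset v <= s ++ t} ->
    cancel (h u v) (h v u).
  move=> uu uS uv vS x; rewrite /h; have [xu|xu] := boolP (x \in c u).
    by rewrite index_uniq ?uc ?(sc v) // -?(sc u) ?index_mem // nth_index.
  have xv : x \notin c v by rewrite inc // -(inc u).
  rewrite [nth x (c v) _]nth_default ?nth_default //.
    by rewrite leqNgt (sc u) // -(sc v) // index_mem.
  by rewrite leqNgt (sc v) // -(sc u) // index_mem.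
exists (h s t); first by exists (h t s); apply: hK.
apply: (@eq_from_nth _ 0%N); rewrite size_map // => i i_s.
rewrite (nth_map 0%N) // /h index_cat mem_nth // index_uniq //.
by rewrite nth_cat -st i_s (set_nth_default 0%N) // -st.
Qed.

Lemma symmetric_seriesP n (f : series (vars n)) : symmetric_series f <->
  (forall m e, block e m -> {in finsupp m &, injective e} ->
     f (push e m) = nsgn e m * f m).
Proof.
split=> [fs m e eb einj|fs e ebij eb m m' mm']; last first.
  have einj : {in finsupp m &, injective e} by move=> v w _ _; apply: bij_inj.
  rewrite -fs //; congr (f _); apply: push_uniq => // v vm'.
  have [e' eK e'K] := ebij; exists (e' v) => //.
  by rewrite mem_finsupp -mm' e'K -mem_finsupp.
pose s (k : 'I_n) := [seq v.2 | v : vars n <- finsupp m & v.1 == k].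
pose t (k : 'I_n) := [seq (e v).2 | v : vars n <- finsupp m & v.1 == k].
have /choice[h hP] (k : 'I_n) : exists h : nat -> nat, bijective h /\ map h (s k) = t k.
  suff [h hb hst] : exists2 h : nat -> nat, bijective h & map h (s k) = t k by exists h.
  apply: extend_inj; last by rewrite !size_map.
    rewrite map_inj_in_uniq ?filter_uniq ?fset_uniq // => -[v1 v2] [w1 w2].
    by rewrite !mem_filter /= => /andP[/eqP -> _] /andP[/eqP -> _] ->.
  rewrite map_inj_in_uniq ?filter_uniq ?fset_uniq // => v w.
  rewrite !mem_filter => /andP[/eqP v1 vm] /andP[/eqP w1 wm] evw; apply: einj => //.
  have := eb w wm; have := eb v vm; rewrite v1 w1.
  by case: (e v) (e w) evw => [? ?] [? ?] /= -> -> ->.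
pose g (v : vars n) : vars n := (v.1, h v.1 v.2).
have ge : {in finsupp m, g =1 e}.
  move=> v vm; rewrite /g; have := (hP v.1).2; rewrite /s /t -map_comp => /eq_in_map.
  move=> /(_ v); rewrite mem_filter eqxx vm => /(_ isT) /= ->.
  by rewrite -eb // -surjective_pairing.
have gb : bijective g.
  have /choice[h' hK] (k : 'I_n) : exists h', cancel (h k) h' /\ cancel h' (h k).
    by case: (hP k) => -[h' ? ?] _; exists h'.
  exists (fun v => (v.1, h' v.1 v.2)) => -[k i]; rewrite /g /=.
    by rewrite (hK k).1.
  by rewrite (hK k).2.
have ginj : {in finsupp m &, injective g} by move=> v w _ _; apply: bij_inj.
rewrite -(eq_push ginj ge) -(eq_nsgn ge); apply: fs => // v.
have [vm|vm] := boolP (v \in finsupp m); first by rewrite (pushE ginj).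
rewrite (fsfun_dflt vm) pushN // => w wm /(bij_inj gb) wv.
by rewrite -wv wm in vm.
Qed.

Section Rename.
Variables (p q : nat) (g : 'I_p -> 'I_q).

Definition rename_var (v : vars p) : vars q := (g v.1, v.2).

Definition pull (m : mono (vars q)) : mono (vars p) :=
  [fsfun v in [fset ((k, w.2) : vars p) | k : 'I_p, w in finsupp m]%fset =>
     m (rename_var v)].

(* The series f with its k-th set of variables renamed as the (g k)-th one. *)
Definition rename_sets (f : series (vars p)) : series (vars q) := fun m =>
  if all (fun w : vars q => w.1 \in codom g) (finsupp m) then f (pull m) else 0.

Lemma pullE m v : pull m v = m (rename_var v).
Proof.
rewrite fsfunE; case: ifPn => // vm; apply/esym/fsfun_dflt.
apply: contra vm => vm; apply/imfset2P; exists v.1 => //.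
by exists (rename_var v) => //; rewrite /= -surjective_pairing.
Qed.

Lemma mem_pull m v : (v \in finsupp (pull m)) = (rename_var v \in finsupp m).
Proof. by rewrite !mem_finsupp pullE. Qed.

Hypothesis gh : {homo g : i j / (i < j)%O}.

Lemma rename_var_homo : {homo rename_var : v w / (v < w)%O}.
Proof.
move=> v w; rewrite !ltEprodlexi /= => /andP[]; rewrite le_eqVlt => /orP[/eqP->|vw].
  by rewrite !lexx.
by move=> _; have := gh vw => gvw; rewrite (ltW gvw) leNgt gvw.
Qed.

Lemma rename_var_inj : injective rename_var.
Proof.
move=> v w E; have [vw|wv|//] := ltgtP v w.
  by have := rename_var_homo vw; rewrite E ltxx.
by have := rename_var_homo wv; rewrite E ltxx.
Qed.

Lemma push_pull m : all (fun w : vars q => w.1 \in codom g) (finsupp m) ->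
  m = push rename_var (pull m).
Proof.
move=> /allP mg; apply: push_uniq => [v w _ _|v _|w wm]; first exact: rename_var_inj.
  by rewrite pullE.
have /codomP[k wk] := mg _ wm; exists ((k, w.2) : vars p); last first.
  by rewrite /rename_var /= -wk -surjective_pairing.
by rewrite mem_pull /rename_var /= -wk -surjective_pairing.
Qed.

Lemma bounded_rename f : bounded_degree f -> bounded_degree (rename_sets f).
Proof.
move=> [N fN]; exists N => m; rewrite /rename_sets; case: ifP => [mg|_].
  move/fN; rewrite -(deg_push (e := rename_var)) -?push_pull //.
  by move=> v w _ _; apply: rename_var_inj.
by rewrite eqxx.
Qed.

End Rename.

Lemma nsgn_comp (d1 d2 d3 : Order.disp_t) (I : orderType d1) (J : orderType d2)
    (K : orderType d3) (r : I -> J) (e : J -> K) (m : mono I) :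
  {in finsupp m &, {homo r : i j / (i < j)%O}} ->
  nsgn e (push r m) = nsgn (e \o r) m.
Proof.
move=> rh; have rinj := incr_inj rh.
have st : {subset tsupp m <= finsupp m} by move=> i; rewrite inE => /andP[].
have mono_r : {in finsupp m &, {mono r : i j / (i < j)%O}}.
  move=> i j im jm; have [ij|ji|->] := ltgtP i j; first exact: rh.
    by rewrite (lt_gtF (rh _ _ jm im ji)).
  by rewrite ltxx.
rewrite /nsgn tsupp_push // big_imfset /=; last by move=> i j /st ? /st ?; apply: rinj.
apply: eq_big_seq => i /st im; rewrite big_mkcond big_imfset /=; last first.
  by move=> k l /st ? /st ?; apply: rinj.
by rewrite [RHS]big_mkcond; apply: eq_big_seq => j /st jm; rewrite mono_r.
Qed.

Lemma eq_nsgn_comp (d1 d2 d3 : Order.disp_t) (I : orderType d1) (J : orderType d2)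
    (K : orderType d3) (r : J -> K) (e : I -> J) (m : mono I) :
  {in finsupp m &, injective e} ->
  {in [fset e i | i in finsupp m]%fset &, {homo r : i j / (i < j)%O}} ->
  nsgn (r \o e) m = nsgn e m.
Proof.
move=> einj rh.
have im_e i : i \in tsupp m -> e i \in [fset e i | i in finsupp m]%fset.
  by rewrite inE => /andP[im _]; apply/imfsetP; exists i.
rewrite /nsgn; apply: eq_big_seq => i im.
rewrite big_seq_cond [RHS]big_seq_cond; apply: eq_bigr => j /andP[jm _] /=.
have [eji|eij|->] := ltgtP (e j) (e i); last by rewrite ltxx.
  by rewrite rh // im_e.
by rewrite ifF // lt_gtF // rh // im_e.
Qed.

Lemma push_comp (d1 d2 d3 : Order.disp_t) (I : orderType d1) (J : orderType d2)
    (K : orderType d3) (r : I -> J) (e : J -> K) (m : mono I) :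
  {in finsupp m &, injective r} -> {in finsupp (push r m) &, injective e} ->
  push e (push r m) = push (e \o r) m.
Proof.
move=> rinj einj.
have rm i : i \in finsupp m -> r i \in finsupp (push r m).
  by move=> im; rewrite finsupp_push //; apply/imfsetP; exists i.
apply: push_uniq => [i j im jm /=|i im|j].
- by move/einj => /(_ (rm _ im) (rm _ jm)) /rinj; apply.
- by rewrite /= (pushE einj) ?rm // (pushE rinj).
- rewrite finsupp_push // => /imfsetP[/= k + ->].
  by rewrite finsupp_push // => /imfsetP[/= i im ->]; exists i.
Qed.

(* The monomial of dotted composition a in the first variables. *)
Definition comp_mono (a : seq (bool * nat)) : mono (vars 1) :=
  [fsfun v in [fset ((ord0, i) : vars 1) | i in iota 0 (size a)]%fset =>
     nth (false, 0%N) a v.2].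

(* The (quasi)symmetric f evaluated on the ordered union of n sets of variables:
   the coefficient of a monomial only depends on its dotted composition. *)
Definition eval_sets n (f : series (vars 1)) : series (vars n) :=
  fun m => f (comp_mono (comp m)).

Section Rank.
Variable n : nat.
Implicit Types m : mono (vars n).

Definition rank m (v : vars n) : vars 1 := (ord0, index v (msupp m)).

Lemma index_msupp m : {in finsupp m &, {mono (index^~ (msupp m)) : v w / (v < w)%O >-> (v < w)%N}}.
Proof.
move=> v w vm wm /=; have h x y : x \in finsupp m -> y \in finsupp m ->
    (index x (msupp m) < index y (msupp m))%N -> (x < y)%O.
  move=> xm ym /(sorted_ltn_nth lt_trans x (msupp_lt m)).
  by rewrite !inE !index_mem !mem_msupp xm ym !nth_index ?mem_msupp //; apply.
apply/idP/idP => [|vw]; first exact: h.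
rewrite ltnNge leq_eqVlt; apply/negP => /orP[/eqP|/(h _ _ wm vm) wv].
  move/(congr1 (nth v (msupp m))); rewrite !nth_index ?mem_msupp // => wv.
  by rewrite wv ltxx in vw.
by rewrite (lt_gtF vw) in wv.
Qed.

Lemma rank_homo m : {in finsupp m &, {homo rank m : v w / (v < w)%O}}.
Proof. by move=> v w vm wm vw; rewrite ltEprodlexi; apply/andP; split=> //; apply/implyP => _; rewrite ltEnat /= index_msupp. Qed.

Lemma comp_monoE m : comp_mono (comp m) = push (rank m) m.
Proof.
apply: push_uniq => [|v vm|[k i]].
- exact/incr_inj/rank_homo.
- rewrite fsfunE /rank /=; have im : (index v (msupp m) < size (comp m))%N.
    by rewrite size_map index_mem mem_msupp.
  rewrite ifT; last by apply/imfsetP; exists (index v (msupp m)); rewrite //= mem_iota.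
  by rewrite (nth_map v) ?index_mem ?mem_msupp // nth_index ?mem_msupp.
- rewrite mem_finsupp fsfunE; case: ifP; last by rewrite eqxx.
  case/imfsetP => /= j; rewrite mem_iota size_map add0n => /andP[_ js] [_ ->] _.
  have [v0 _] : exists v, v \in msupp m.
    by case: (msupp m) js => // v s _; exists v; rewrite inE eqxx.
  exists (nth v0 (msupp m) j); first by rewrite -mem_msupp mem_nth.
  by rewrite /rank index_uniq ?msupp_uniq // (ord1 k).
Qed.

Lemma bounded_eval f : bounded_degree f -> bounded_degree (eval_sets f : series (vars n)).
Proof.
move=> [N fN]; exists N => m; rewrite /eval_sets comp_monoE => /fN.
by rewrite deg_push //; apply/incr_inj/rank_homo.
Qed.

End Rank.

Definition rank_conj n (e : vars n -> vars n) (m : mono (vars n)) (v : vars 1) : vars 1 :=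
  nth v [seq rank (push e m) (e w) | w <- msupp m] v.2.

Lemma rank_conjE n (e : vars n -> vars n) m v : v \in finsupp m ->
  rank_conj e m (rank m v) = rank (push e m) (e v).
Proof.
move=> vm; rewrite /rank_conj (nth_map v) ?index_mem ?mem_msupp //.
by rewrite nth_index ?mem_msupp.
Qed.

Section Invariance.
Variable adm : forall n, mono (vars n) -> (vars n -> vars n) -> Prop.
Hypothesis adm_inj : forall n (m : mono (vars n)) e,
  adm m e -> {in finsupp m &, injective e}.
Hypothesis adm_block : forall n (m : mono (vars n)) e, adm m e -> block e m.
Hypothesis adm_sub : forall n (a m : mono (vars n)) e,
  (finsupp a `<=` finsupp m)%fset -> adm m e -> adm a e.
Hypothesis adm_pull : forall p q (g : 'I_p -> 'I_q) (m : mono (vars q)) e,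
  {homo g : i j / (i < j)%O} -> adm m e ->
  adm (pull g m) (fun v => (v.1, (e (rename_var g v)).2)).
Hypothesis adm_rank : forall n (m : mono (vars n)) e,
  adm m e -> adm (push (rank m) m) (rank_conj e m).

Definition relabel_invariant n (f : series (vars n)) : Prop :=
  forall m e, adm m e -> f (push e m) = nsgn e m * f m.

Lemma invariant_lin n k (f g : series (vars n)) :
  relabel_invariant f -> relabel_invariant g -> relabel_invariant (k *: f + g).
Proof.
move=> fi gi m e me.
have E m0 : (k *: f + g) m0 = k * f m0 + g m0 by [].
by rewrite !E fi // gi // mulrDr; congr (_ + _); rewrite mulrCA.
Qed.

Lemma invariant1 n : relabel_invariant (1 : series (vars n)).
Proof.
move=> m e me; rewrite /GRing.one /= /sone push_eq1; last exact: adm_inj me.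
by have [->|_] := eqVneq m mono1; rewrite ?nsgn1 ?mulr1 ?mulr0.
Qed.

Lemma invariantM n (f g : series (vars n)) :
  relabel_invariant f -> relabel_invariant g -> relabel_invariant (f * g).
Proof.
move=> fi gi m e me; have einj := adm_inj me.
rewrite mul_push // smulE mulr_fsumr; apply: eq_fsbigr => -[a b] /set_mem /= abm.
have am : adm a e by apply: adm_sub me; rewrite -abm finsupp_mmull.
have bm : adm b e by apply: adm_sub me; rewrite -abm finsupp_mmulr.
rewrite fi // gi // [_ * f a * _]mulrACA [LHS]mulrA nsgn_mul; last by rewrite abm.
by rewrite abm -!mulrA.
Qed.

Lemma invariant_rename p q (g : 'I_p -> 'I_q) (f : series (vars p)) :
  {homo g : i j / (i < j)%O} ->
  relabel_invariant f -> relabel_invariant (rename_sets g f).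
Proof.
move=> gh fi m e me; rewrite /rename_sets.
have einj := adm_inj me; have eb := adm_block me.
have -> : all (fun w : vars q => w.1 \in codom g) (finsupp (push e m)) =
          all (fun w : vars q => w.1 \in codom g) (finsupp m).
  rewrite finsupp_push //; apply/allP/allP => h w wm.
    by rewrite -eb //; apply: h; apply/imfsetP; exists w.
  by case/imfsetP: wm => /= v vm ->; rewrite eb //; apply: h.
case: ifP => [mg|_]; last by rewrite mulr0.
pose e' (v : vars p) : vars p := (v.1, (e (rename_var g v)).2).
have me' := adm_pull gh me : adm (pull g m) e'.
have e'E : {in finsupp (pull g m), rename_var g \o e' =1 e \o rename_var g}.
  move=> v; rewrite mem_pull => /eb; rewrite /rename_var /=.
  by case: (e _) => ? ? /= ->.
have rinj : {in finsupp (pull g m) &, injective (rename_var g)}.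
  by move=> v w _ _; apply: rename_var_inj.
have e'inj := adm_inj me'.
have -> : pull g (push e m) = push e' (pull g m).
  apply: push_uniq => [||w] //.
    by move=> v vm; rewrite !pullE [rename_var g _]e'E // (pushE einj) // -mem_pull.
  rewrite mem_pull finsupp_push // => /imfsetP[/= v vm wv].
  have /codomP[k vk] := allP mg _ vm.
  have vE : v = rename_var g ((k, v.2) : vars p).
    by rewrite /rename_var /= -vk -surjective_pairing.
  exists ((k, v.2) : vars p); first by rewrite mem_pull -vE.
  apply: (rename_var_inj gh); rewrite wv [LHS]e'E /= -?vE //.
  by rewrite mem_pull -vE.
rewrite fi //; congr (_ * _).
transitivity (nsgn (rename_var g \o e') (pull g m)).
  by rewrite eq_nsgn_comp // => v w _ _; apply: rename_var_homo.
rewrite (eq_nsgn e'E) -nsgn_comp -?push_pull //.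
by move=> v w _ _; apply: rename_var_homo.
Qed.

Lemma invariant_eval n (f : series (vars 1)) :
  relabel_invariant f -> relabel_invariant (eval_sets f : series (vars n)).
Proof.
move=> fi m e me; rewrite /eval_sets !comp_monoE.
have einj := adm_inj me; have rm := adm_rank me.
have r'inj : {in finsupp (push e m) &, injective (rank (push e m))}.
  exact/incr_inj/rank_homo.
have rinj : {in finsupp m &, injective (rank m)} by exact/incr_inj/rank_homo.
have rE : {in finsupp m, rank (push e m) \o e =1 rank_conj e m \o rank m}.
  by move=> v vm; rewrite /= rank_conjE.
rewrite push_comp //; rewrite (eq_push _ rE); last first.
  move=> v w vm wm /r'inj; rewrite finsupp_push // => h.
  by apply: einj => //; apply: h; apply/imfsetP; [exists v | exists w].
rewrite -push_comp //; last exact: adm_inj rm.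
rewrite fi //; congr (_ * _).
rewrite nsgn_comp; last exact: rank_homo.
rewrite -(eq_nsgn rE) eq_nsgn_comp // -finsupp_push //.
exact: rank_homo.
Qed.

End Invariance.

Definition adm_incr n (m : mono (vars n)) e := block e m /\ increasing_on e m.

Definition adm_block_inj n (m : mono (vars n)) e :=
  block e m /\ {in finsupp m &, injective e}.

Lemma quasisymmetric_inv n (f : series (vars n)) :
  quasisymmetric f <-> relabel_invariant adm_incr f.
Proof.
split=> [/quasisymmetricP fq m e [eb ei]|fi]; first by rewrite fq // nsgn_mono // mul1r.
by apply/quasisymmetricP => m e eb ei; rewrite fi // nsgn_mono // mul1r.
Qed.

Lemma symmetric_inv n (f : series (vars n)) :
  symmetric_series f <-> relabel_invariant adm_block_inj f.
Proof.
split=> [/symmetric_seriesP fs m e [eb ei]|fi]; first exact: fs.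
by apply/symmetric_seriesP => m e eb ei; exact: fi.
Qed.

Lemma block_sub n (a m : mono (vars n)) e :
  (finsupp a `<=` finsupp m)%fset -> block e m -> block e a.
Proof. by move=> /fsubsetP am eb v /am; apply: eb. Qed.

Lemma block_pull p q (g : 'I_p -> 'I_q) (m : mono (vars q)) (e : vars q -> vars q) :
  block (fun v : vars p => (v.1, (e (rename_var g v)).2) : vars p) (pull g m).
Proof. by []. Qed.

Lemma block1 (m : mono (vars 1)) e : block e m.
Proof. by move=> v _; rewrite !ord1. Qed.

Lemma ltxi_block q (v w : vars q) : v.1 = w.1 -> (v < w)%O = (v.2 < w.2)%O.
Proof. by move=> vw; rewrite ltEprodlexi vw lexx. Qed.

Lemma adm_incr_inj n (m : mono (vars n)) e :
  adm_incr m e -> {in finsupp m &, injective e}.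
Proof. by move=> [_]; exact: incr_inj. Qed.

Lemma adm_incr_sub n (a m : mono (vars n)) e :
  (finsupp a `<=` finsupp m)%fset -> adm_incr m e -> adm_incr a e.
Proof.
move=> am [eb ei]; split; first exact: block_sub eb.
by move=> v w /(fsubsetP am) vm /(fsubsetP am) wm; apply: ei.
Qed.

Lemma adm_incr_pull p q (g : 'I_p -> 'I_q) (m : mono (vars q)) e :
  {homo g : i j / (i < j)%O} -> adm_incr m e ->
  adm_incr (pull g m) (fun v => (v.1, (e (rename_var g v)).2)).
Proof.
move=> gh [eb ei]; split; first exact: block_pull.
move=> v w; rewrite !mem_pull => vm wm vw.
have := ei _ _ vm wm (rename_var_homo gh vw).
move: vw; rewrite !ltEprodlexi /= !eb //= => /andP[vw].
rewrite vw /=; have [vw1 _|] := boolP (w.1 <= v.1)%O => //.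
have -> : w.1 = v.1 by apply/le_anti/andP.
by rewrite lexx.
Qed.

Lemma mem_push_rank n (m : mono (vars n)) v : v \in finsupp (push (rank m) m) ->
  exists2 w, w \in finsupp m & v = rank m w.
Proof.
rewrite finsupp_push; last exact/incr_inj/rank_homo.
by move/imfsetP => -[/= w wm ->]; exists w.
Qed.

Lemma adm_incr_rank n (m : mono (vars n)) e :
  adm_incr m e -> adm_incr (push (rank m) m) (rank_conj e m).
Proof.
move=> [eb ei]; split; first exact: block1.
move=> _ _ /mem_push_rank[v vm ->] /mem_push_rank[w wm ->] vw.
have einj := incr_inj ei.
rewrite !rank_conjE //; apply: rank_homo.
- by rewrite finsupp_push //; apply/imfsetP; exists v.
- by rewrite finsupp_push //; apply/imfsetP; exists w.
apply: ei => //; have [//|wv|E] := ltgtP v w.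
  by have := rank_homo wm vm wv; rewrite (lt_gtF vw).
by rewrite E ltxx in vw.
Qed.

Lemma adm_bi_sub n (a m : mono (vars n)) e :
  (finsupp a `<=` finsupp m)%fset -> adm_block_inj m e -> adm_block_inj a e.
Proof.
move=> am [eb ei]; split; first exact: block_sub eb.
exact: subset_inj ei.
Qed.

Lemma adm_bi_pull p q (g : 'I_p -> 'I_q) (m : mono (vars q)) e :
  {homo g : i j / (i < j)%O} -> adm_block_inj m e ->
  adm_block_inj (pull g m) (fun v => (v.1, (e (rename_var g v)).2)).
Proof.
move=> gh [eb ei]; split; first exact: block_pull.
move=> v w; rewrite !mem_pull => vm wm [vw1 vw2].
apply: (rename_var_inj gh); apply: ei => //.
have := eb _ vm; have := eb _ wm; rewrite /= -vw1.
by case: (e _) (e _) vw2 => ? ? [? ?] /= -> -> ->.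
Qed.

Lemma adm_bi_rank n (m : mono (vars n)) e :
  adm_block_inj m e -> adm_block_inj (push (rank m) m) (rank_conj e m).
Proof.
move=> [eb ei]; split; first exact: block1.
move=> _ _ /mem_push_rank[v vm ->] /mem_push_rank[w wm ->].
rewrite !rank_conjE // => /(incr_inj (rank_homo (m := push e m))) h.
congr (rank m _); apply: (ei) => //; apply: h.
- by rewrite finsupp_push //; apply/imfsetP; exists v.
- by rewrite finsupp_push //; apply/imfsetP; exists w.
Qed.

(* Subalgebras of the algebras of series in n sets of variables, n = 0, 1, 2, ...;
   the n-th one serves as the n-th tensor power of the first one. *)
Record series_family := SeriesFamily {
  in_family : forall n, {pred series (vars n)};
  family_subalg : forall n, subalg_closed (@in_family n);
  family_rename : forall p q (g : 'I_p -> 'I_q) f, {homo g : i j / (i < j)%O} ->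
    f \in @in_family p -> rename_sets g f \in @in_family q;
  family_eval : forall n f, f \in @in_family 1 -> eval_sets f \in @in_family n }.

Arguments in_family : clear implicits.

Section FamilyType.
Variables (F : series_family) (n : nat).

Record family_type := FamilyElt {
  family_val :> series (vars n);
  _ : family_val \in in_family F n }.

HB.instance Definition _ := [isSub for family_val].
HB.instance Definition _ := [Choice of family_type by <:].
HB.instance Definition _ :=
  GRing.SubChoice_isSubAlgebra.Build rat (series (vars n)) (in_family F n) family_type
    (family_subalg F n).

End FamilyType.

Arguments family_type : clear implicits.

Definition quasisymmetric_pred n : {pred series (vars n)} :=
  fun f => `[< bounded_degree f /\ quasisymmetric f >].

Definition symmetric_pred n : {pred series (vars n)} :=
  fun f => `[< bounded_degree f /\ symmetric_series f >].

Lemma quasisymmetric_subalg n : subalg_closed (@quasisymmetric_pred n).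
Proof.
split=> [|k f g /asboolP[bf /quasisymmetric_inv fq] /asboolP[bg /quasisymmetric_inv gq]
        |f g /asboolP[bf /quasisymmetric_inv fq] /asboolP[bg /quasisymmetric_inv gq]];
  apply/asboolP; split; try apply/quasisymmetric_inv.
- exact: bounded_one.
- exact: invariant1 adm_incr_inj _.
- exact: bounded_lin.
- exact: invariant_lin.
- exact: bounded_mul.
- exact: (invariantM adm_incr_inj adm_incr_sub).
Qed.

Lemma symmetric_subalg n : subalg_closed (@symmetric_pred n).
Proof.
have inj n' (m : mono (vars n')) e : adm_block_inj m e -> {in finsupp m &, injective e}.
  by case.
split=> [|k f g /asboolP[bf /symmetric_inv fq] /asboolP[bg /symmetric_inv gq]
        |f g /asboolP[bf /symmetric_inv fq] /asboolP[bg /symmetric_inv gq]];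
  apply/asboolP; split; try apply/symmetric_inv.
- exact: bounded_one.
- exact: invariant1 inj _.
- exact: bounded_lin.
- exact: invariant_lin.
- exact: bounded_mul.
- exact: (invariantM inj adm_bi_sub).
Qed.

Lemma quasisymmetric_rename p q (g : 'I_p -> 'I_q) f : {homo g : i j / (i < j)%O} ->
  f \in @quasisymmetric_pred p -> rename_sets g f \in @quasisymmetric_pred q.
Proof.
move=> gh /asboolP[bf /quasisymmetric_inv fq]; apply/asboolP; split.
  exact: bounded_rename.
apply/quasisymmetric_inv.
exact: (invariant_rename adm_incr_inj (fun _ _ _ => @proj1 _ _) adm_incr_pull).
Qed.

Lemma symmetric_rename p q (g : 'I_p -> 'I_q) f : {homo g : i j / (i < j)%O} ->
  f \in @symmetric_pred p -> rename_sets g f \in @symmetric_pred q.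
Proof.
move=> gh /asboolP[bf /symmetric_inv fq]; apply/asboolP; split.
  exact: bounded_rename.
apply/symmetric_inv.
exact: (invariant_rename (fun _ _ _ => @proj2 _ _) (fun _ _ _ => @proj1 _ _) adm_bi_pull).
Qed.

Lemma quasisymmetric_eval n f :
  f \in @quasisymmetric_pred 1 -> eval_sets f \in @quasisymmetric_pred n.
Proof.
move=> /asboolP[bf /quasisymmetric_inv fq]; apply/asboolP; split.
  exact: bounded_eval.
apply/quasisymmetric_inv; exact: (invariant_eval adm_incr_inj adm_incr_rank).
Qed.

Lemma symmetric_eval n f :
  f \in @symmetric_pred 1 -> eval_sets f \in @symmetric_pred n.
Proof.
move=> /asboolP[bf /symmetric_inv fq]; apply/asboolP; split.
  exact: bounded_eval.
apply/symmetric_inv; exact: (invariant_eval (fun _ _ _ => @proj2 _ _) adm_bi_rank).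
Qed.

Definition quasisymmetric_family : series_family :=
  SeriesFamily quasisymmetric_subalg quasisymmetric_rename quasisymmetric_eval.

Definition symmetric_family : series_family :=
  SeriesFamily symmetric_subalg symmetric_rename symmetric_eval.

Section Operations.
Variable F : series_family.

Lemma lshift_homo p q : {homo @lshift p q : i j / (i < j)%O}.
Proof. by []. Qed.

Lemma rshift_homo p q : {homo @rshift p q : i j / (i < j)%O}.
Proof. by move=> i j; rewrite !ltEord /= ltn_add2l. Qed.

Lemma tensor_subproof p q (f : family_type F p) (g : family_type F q) :
  rename_sets (@lshift p q) f * rename_sets (@rshift p q) g \in in_family F (p + q)%N.
Proof.
case: (family_subalg F (p + q)%N) => _ _; apply.
  by apply: family_rename; [exact: lshift_homo | exact: valP].
by apply: family_rename; [exact: rshift_homo | exact: valP].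
Qed.

(* f tensor g is f(x; theta) g(y; phi), with the variables of g put after those
   of f. *)
Definition tensor p q (f : family_type F p) (g : family_type F q) :
  family_type F (p + q)%N := FamilyElt (tensor_subproof f g).

Definition coproduct (f : family_type F 1) : family_type F 2 :=
  FamilyElt (family_eval 2 (valP f)).

(* The projection on the component of degree 0, which consists of constants. *)
Definition constant_term (f : family_type F 1) : rat := (f : series _) mono1.

Definition total_part (n : nat) : set (family_type F 1) :=
  [set f | forall m, (f : series _) m != 0 -> (xdeg m + tdeg m)%N = n].

Definition fermionic_part (n : nat) : set (family_type F 1) :=
  [set f | forall m, (f : series _) m != 0 -> tdeg m = n].

End Operations.

Definition bilinear_map (U V W : lmodType rat) (b : U -> V -> W) : Prop :=
  (forall u, linear (b u)) /\ (forall v, linear (b^~ v)).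

Definition is_tensor (U V T : lmodType rat) (t : U -> V -> T) : Prop :=
  bilinear_map t /\
  forall (W : lmodType rat) (b : U -> V -> W), bilinear_map b ->
    exists! h : T -> W, linear h /\ forall u v, h (t u v) = b u v.

(* The linear map T -> W induced by the bilinear map b, unique by is_tensor
   (and the zero map if b induces no linear map). *)
Definition tensor_lift (U V T W : lmodType rat) (t : U -> V -> T) (b : U -> V -> W) :
    T -> W :=
  xget (fun=> 0) [set h : T -> W | linear h /\ forall u v, h (t u v) = b u v].

(* The map f (x) g between tensor products. *)
Definition tensor_map (U V T U' V' T' : lmodType rat) (t : U -> V -> T)
    (t' : U' -> V' -> T') (f : U -> U') (g : V -> V') : T -> T' :=
  tensor_lift t (fun u v => t' (f u) (g v)).

(* An algebra H with its tensor square (as an algebra) and cube, the maps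
   H x H -> H2, H2 x H -> H3 and H x H2 -> H3, the coproduct, the counit, and the
   homogeneous parts for the grading and for the fermionic degree. *)
Record hopf_data := HopfData {
  hd_alg :> algType rat;
  hd_sq : algType rat;
  hd_cube : lmodType rat;
  hd_tens : hd_alg -> hd_alg -> hd_sq;
  hd_tens21 : hd_sq -> hd_alg -> hd_cube;
  hd_tens12 : hd_alg -> hd_sq -> hd_cube;
  hd_coprod : hd_alg -> hd_sq;
  hd_counit : hd_alg -> rat;
  hd_deg : nat -> set hd_alg;
  hd_fdeg : nat -> set hd_alg }.

Definition family_hopf (F : series_family) : hopf_data :=
  @HopfData (family_type F 1) (family_type F 2) (family_type F 3)
    (@tensor F 1 1) (@tensor F 2 1) (@tensor F 1 2) (@coproduct F) (@constant_term F)
    (@total_part F) (@fermionic_part F).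

(* V is the direct sum of the subspaces G n. *)
Definition is_grading (V : lmodType rat) (G : nat -> set V) : Prop :=
  [/\ forall n, G n 0 /\ forall (k : rat) u v, G n u -> G n v -> G n (k *: u + v),
      forall u, exists N (c : nat -> V), (forall i, G i (c i)) /\ u = \sum_(i < N) c i
    & forall N (c : nat -> V), (forall i, G i (c i)) -> \sum_(i < N) c i = 0 ->
        forall i, (i < N)%N -> c i = 0].

Section HopfAxioms.
Variable H : hopf_data.
Local Notation "f ⊗ g" := (@hd_tens H f g) (at level 40).
Local Notation Delta := (@hd_coprod H).
Local Notation eps := (@hd_counit H).
Local Notation mult := (tensor_lift (@hd_tens H) (fun f g : H => f * g)).
Local Notation endo_tensor := (tensor_map (@hd_tens H) (@hd_tens H)).

Definition is_antipode (S : H -> H) : Prop :=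
  [/\ linear S,
      forall f, mult (endo_tensor S id (Delta f)) = (eps f)%:A
    & forall f, mult (endo_tensor id S (Delta f)) = (eps f)%:A].

Record is_graded_hopf_algebra : Prop := GradedHopfAlgebra {
  gh_tensor : is_tensor (@hd_tens H);
  gh_tensor21 : is_tensor (@hd_tens21 H);
  gh_tensor12 : is_tensor (@hd_tens12 H);
  gh_tensorA : forall f g h : H, hd_tens21 (f ⊗ g) h = hd_tens12 f (g ⊗ h);
  gh_fdeg : is_grading (@hd_fdeg H);
  gh_fdegM : forall p q (f g : H), hd_fdeg p f -> hd_fdeg q g -> hd_fdeg (p + q)%N (f * g);
  gh_deg : is_grading (@hd_deg H);
  gh_deg1 : hd_deg 0 (1 : H);
  gh_degM : forall p q (f g : H), hd_deg p f -> hd_deg q g -> hd_deg (p + q)%N (f * g);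
  gh_deg_coprod : forall n (f : H), hd_deg n f ->
    exists s : seq (H * H), Delta f = \sum_(x <- s) x.1 ⊗ x.2 /\
      forall x, x \in s -> exists i j, [/\ (i + j)%N = n, hd_deg i x.1 & hd_deg j x.2];
  gh_deg_counit : forall n (f : H), (0 < n)%N -> hd_deg n f -> eps f = 0;
  gh_sq1 : 1 = 1 ⊗ 1;
  gh_sqM : forall p q (f1 g1 f2 g2 : H), hd_fdeg p g1 -> hd_fdeg q f2 ->
    (f1 ⊗ g1) * (f2 ⊗ g2) = (-1) ^+ (p * q)%N *: ((f1 * f2) ⊗ (g1 * g2));
  gh_coprod_linear : linear Delta;
  gh_coprod1 : Delta 1 = 1;
  gh_coprodM : {morph Delta : f g / f * g};
  gh_counit_linear : scalar eps;
  gh_counit1 : eps 1 = 1;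
  gh_counitM : {morph eps : f g / f * g};
  gh_coassoc : forall f,
    tensor_map (@hd_tens H) (@hd_tens21 H) Delta id (Delta f) =
    tensor_map (@hd_tens H) (@hd_tens12 H) id Delta (Delta f);
  gh_counitl : forall f, tensor_lift (@hd_tens H) (fun g h => eps g *: h) (Delta f) = f;
  gh_counitr : forall f, tensor_lift (@hd_tens H) (fun g h => eps h *: g) (Delta f) = f;
  gh_antipode : exists S, is_antipode S }.

Definition is_connected : Prop :=
  exists2 e : H, e != 0 & forall f, hd_deg 0 f <-> exists k : rat, f = k *: e.

Definition is_supercommutative : Prop :=
  forall p q (f g : H), hd_fdeg p f -> hd_fdeg q g -> f * g = (-1) ^+ (p * q)%N *: (g * f).

End HopfAxioms.

Record is_hopf_embedding (B A : hopf_data) (i : B -> A) : Prop := HopfEmbedding {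
  he_inj : injective i;
  he_linear : linear i;
  he_one : i 1 = 1;
  he_mul : {morph i : f g / f * g};
  he_coprod : forall f,
    hd_coprod (i f) = tensor_map (@hd_tens B) (@hd_tens A) i i (hd_coprod f);
  he_counit : forall f, hd_counit (i f) = hd_counit f;
  he_antipode : forall (SB : B -> B) (SA : A -> A), is_antipode SB -> is_antipode SA ->
    forall f, i (SB f) = SA (i f) }.

Definition sQSym : hopf_data := family_hopf quasisymmetric_family.
Definition Lambda : hopf_data := family_hopf symmetric_family.

(* Main.v *)
(* A series in an ordered union of two alphabets is a matrix indexed by pairs of
   monomials, and f tensor g is the rank one matrix f(a) g(b) without any sign, because
   the first alphabet precedes the second one. Bounded degree makes the matrix of a
   (quasi)symmetric series have finitely many different columns, so Gaussian
   elimination gives the universal property of the tensor product. The coefficient of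
   a (quasi)symmetric series at m only depends on the dotted composition of m, and the
   composition of a monomial in an ordered union is the concatenation of the two
   compositions; this gives coassociativity and the counit laws. The antipode is the
   geometric series of convolution powers of the augmentation projection, locally
   finite by grading and connectedness, and it is compatible with the inclusion of
   Lambda because convolution inverses are unique. *)
From HB Require Import structures.
From mathcomp Require Import all_boot all_order all_algebra finmap.
From mathcomp Require Import boolp classical_sets functions cardinality fsbigop.
Require Import Defs.

Set Implicit Arguments.
Unset Strict Implicit.
Unset Printing Implicit Defensive.

Import Order.TTheory GRing.Theory Num.Theory.

Local Open Scope classical_set_scope.
Local Open Scope ring_scope.

(** * Tensor products *)

Section LinearMaps.
Variables (U V : lmodType rat) (h : U -> V).
Hypothesis hl : linear h.

Lemma lin0 : h 0 = 0.
Proof. by have := hl (-1) 0 0; rewrite scaler0 addr0 scaleN1r addNr. Qed.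

Lemma linD u v : h (u + v) = h u + h v.
Proof. by have := hl 1 u v; rewrite !scale1r. Qed.

Lemma linZ k u : h (k *: u) = k *: h u.
Proof. by have := hl k u 0; rewrite lin0 !addr0. Qed.

Lemma linB u v : h (u - v) = h u - h v.
Proof. by rewrite linD -scaleN1r linZ scaleN1r. Qed.

Lemma lin_sum (I : Type) (s : seq I) (P : pred I) (G : I -> U) :
  h (\sum_(i <- s | P i) G i) = \sum_(i <- s | P i) h (G i).
Proof. exact: (big_morph h linD lin0). Qed.

End LinearMaps.

Lemma lin_comp (U V W : lmodType rat) (h : V -> W) (g : U -> V) :
  linear h -> linear g -> linear (h \o g).
Proof. by move=> hl gl k u v; rewrite /= gl hl. Qed.

Lemma lin_add (U V : lmodType rat) (h g : U -> V) : linear h -> linear g ->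
  linear (fun u => h u + g u).
Proof. by move=> hl gl k u v; rewrite hl gl scalerDr addrACA. Qed.

Lemma lin_opp (U V : lmodType rat) (h : U -> V) : linear h -> linear (fun u => - h u).
Proof. by move=> hl k u v; rewrite hl opprD scalerN. Qed.

Lemma lin_scale (U V : lmodType rat) (h : U -> V) a : linear h ->
  linear (fun u => a *: h u).
Proof. by move=> hl k u v; rewrite hl scalerDr !scalerA mulrC. Qed.

Lemma lin_sum_of (U V : lmodType rat) (I : Type) (s : seq I) (h : I -> U -> V) :
  (forall i, linear (h i)) -> linear (fun u => \sum_(i <- s) h i u).
Proof.
move=> hl k u v; rewrite scaler_sumr -big_split /=.
by apply: eq_bigr => i _; rewrite hl.
Qed.

Section TensorCriterion.
Variables (U V T : lmodType rat) (t : U -> V -> T).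
Local Notation tsum s := (\sum_(x <- s) t x.1 x.2).
Hypothesis t_bilin : bilinear_map t.
Hypothesis t_span : forall x, exists s, x = tsum s.
(** [g] contracts the left factor by the functional [r]. For series, [r] will be a coefficient and
    [g] a row of the matrix. *)
Hypothesis t_slice : forall u : U, u != 0 -> exists r : U -> rat, exists g : T -> V,
  [/\ scalar r, r u != 0, linear g & forall u' v, g (t u' v) = r u' *: v].

(* Gaussian elimination: a functional not killing the left factor of the first
   term expresses its right factor by the others, which leaves a shorter sum. *)
Lemma tensor_relation (W : lmodType rat) (b : U -> V -> W) s :
  bilinear_map b -> tsum s = 0 -> \sum_(x <- s) b x.1 x.2 = 0.
Proof.
move=> [bl br]; move: t_bilin => [tl tr].
have [n] := ubnP (size s); elim: n s => // n IH [|[u v] s] /= sn ts.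
  by rewrite big_nil.
rewrite big_cons /=; rewrite big_cons /= in ts.
have [u0|/t_slice[r [g [rl ru gl gt]]]] := eqVneq u 0.
  move: ts; rewrite u0 (lin0 (tr v)) (lin0 (br v)) !add0r; exact: IH.
pose c (x : U * V) := r x.1 / r u.
have vE : v = - \sum_(x <- s) c x *: x.2.
  apply/eqP; rewrite -addr_eq0; apply/eqP.
  apply: (scalerI ru); rewrite scaler0; apply: etrans (etrans (congr1 g ts) (lin0 gl)).
  rewrite (linD gl) (lin_sum gl) gt scalerDr scaler_sumr; congr (_ + _).
  by apply: eq_bigr => x _; rewrite gt scalerA mulrC divfK.
(* Substituting [vE] absorbs the first term into the others. [E] says so for every bilinear map, in
   particular for [t] and for [b]. *)
pose s' := [seq (x.1 - c x *: u, x.2) | x <- s].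
have E (X : lmodType rat) (b' : U -> V -> X) : bilinear_map b' ->
    \sum_(x <- s') b' x.1 x.2 = b' u v + \sum_(x <- s) b' x.1 x.2.
  move=> [bl' br']; rewrite big_map /=.
  under eq_bigr do rewrite (linB (br' _)) (linZ (br' _)) -(linZ (bl' _)).
  by rewrite sumrB -(lin_sum (bl' u)) vE -scaleN1r (linZ (bl' u)) scaleN1r addrC.
rewrite -E //; apply: IH; first by rewrite size_map.
by rewrite E.
Qed.

(** The induced map evaluates [b] on a chosen expression by pure tensors. [tensor_relation] makes
    the value independent of the choice, and linearity follows. *)
Lemma is_tensor_intro : is_tensor t.
Proof.
split=> // W b bb; have [bl br] := bb; have [tl tr] := t_bilin.
have /choice[sp spE] := t_span.
pose B (s : seq (U * V)) := \sum_(x <- s) b x.1 x.2.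
have Beq s s' : tsum s = tsum s' -> B s = B s'.
  move=> ss'; apply/eqP; rewrite -subr_eq0; apply/eqP.
  (* Negating the left factors of [s'] turns the difference of two expressions into a single one. *)
  pose s2 := s ++ [seq (- x.1, x.2) | x <- s'].
  have E (X : lmodType rat) (b' : U -> V -> X) : bilinear_map b' ->
      \sum_(x <- s2) b' x.1 x.2 = \sum_(x <- s) b' x.1 x.2 - \sum_(x <- s') b' x.1 x.2.
    move=> [bl' br']; rewrite big_cat big_map /= -sumrN; congr (_ + _).
    by apply: eq_bigr => x _; rewrite -scaleN1r (linZ (br' _)) scaleN1r.
  by rewrite /B -E //; apply: tensor_relation; rewrite // E // ss' subrr.
exists (fun x => B (sp x)); split.
  split=> [k x y|u v]; last first.
    rewrite (Beq _ [:: (u, v)]); first by rewrite /B big_seq1.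
    by rewrite -spE big_seq1.
  pose s2 := [seq (k *: z.1, z.2) | z <- sp x] ++ sp y.
  have E (X : lmodType rat) (b' : U -> V -> X) : bilinear_map b' ->
      \sum_(z <- s2) b' z.1 z.2 =
      k *: (\sum_(z <- sp x) b' z.1 z.2) + \sum_(z <- sp y) b' z.1 z.2.
    move=> [bl' br']; rewrite big_cat big_map /= scaler_sumr; congr (_ + _).
    by apply: eq_bigr => z _; rewrite (linZ (br' _)).
  rewrite (Beq _ s2); first exact: (E _ b).
  by rewrite E // -!spE.
move=> h [hl hb]; apply/funext => x; rewrite {2}(spE x) (lin_sum hl).
by apply: eq_bigr => z _; rewrite hb.
Qed.

End TensorCriterion.

Section TensorLift.
Variables (U V T : lmodType rat) (t : U -> V -> T).
Hypothesis tT : is_tensor t.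

Lemma tensor_bilin : bilinear_map t. Proof. by case: tT. Qed.

Lemma tensor_liftP (W : lmodType rat) (b : U -> V -> W) : bilinear_map b ->
  linear (tensor_lift t b) /\ forall u v, tensor_lift t b (t u v) = b u v.
Proof.
move=> bb; case: tT => _ /(_ W b bb)[h [hP _]].
rewrite /tensor_lift; case: xgetP => [h' _ //|/(_ h)[]]; exact: hP.
Qed.

(** Both maps factor the same bilinear map [h (t u v)], and such a factorization is unique. *)
Lemma tensor_ext (W : lmodType rat) (h h' : T -> W) : linear h -> linear h' ->
  (forall u v, h (t u v) = h' (t u v)) -> h =1 h'.
Proof.
move=> hl hl' hh'; have [tl tr] := tensor_bilin.
have bb : bilinear_map (fun u v => h (t u v)).
  by split=> [u|v] k x y; rewrite ?tl ?tr hl.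
case: tT => _ /(_ W _ bb)[g [_ gu]] x.
rewrite -(gu h); last by split.
by rewrite -(gu h') //; split => // u v; rewrite hh'.
Qed.

Lemma tensor_lift_sum (W : lmodType rat) (b : U -> V -> W) (s : seq (U * V)) :
  bilinear_map b ->
  tensor_lift t b (\sum_(x <- s) t x.1 x.2) = \sum_(x <- s) b x.1 x.2.
Proof.
move=> /tensor_liftP[bl bE]; rewrite (lin_sum bl).
by apply: eq_bigr => x _; rewrite bE.
Qed.

Lemma bilin_comp (U' V' W : lmodType rat) (b : U -> V -> W) (f : U' -> U) (g : V' -> V) :
  bilinear_map b -> linear f -> linear g -> bilinear_map (fun u v => b (f u) (g v)).
Proof.
by move=> [bl br] fl gl; split=> [u|v] k x y; rewrite ?gl ?fl ?bl ?br.
Qed.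

End TensorLift.

Lemma mul_bilin (A : algType rat) : bilinear_map (fun f g : A => f * g).
Proof.
split=> [u|v] k x y; first by rewrite mulrDr scalerAr.
by rewrite mulrDl scalerAl.
Qed.

(** * Convolution and antipodes *)

(** The coalgebra axioms are isolated so that convolution is available before an antipode is known
    to exist. *)
Record is_coalgebra (C : hopf_data) : Prop := Coalgebra {
  co_tensor : is_tensor (@hd_tens C);
  co_tensor21 : is_tensor (@hd_tens21 C);
  co_tensor12 : is_tensor (@hd_tens12 C);
  co_tensorA : forall f g h : C,
    hd_tens21 (hd_tens f g) h = hd_tens12 f (hd_tens g h);
  co_linear : linear (@hd_coprod C);
  co_counit_linear : scalar (@hd_counit C);
  co_assoc : forall f : C,
    tensor_map (@hd_tens C) (@hd_tens21 C) (@hd_coprod C) id (hd_coprod f) =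
    tensor_map (@hd_tens C) (@hd_tens12 C) id (@hd_coprod C) (hd_coprod f);
  co_counitl : forall f : C,
    tensor_lift (@hd_tens C) (fun g h => hd_counit g *: h) (hd_coprod f) = f;
  co_counitr : forall f : C,
    tensor_lift (@hd_tens C) (fun g h => hd_counit h *: g) (hd_coprod f) = f }.

Definition conv (C : hopf_data) (A : algType rat) (phi psi : C -> A) (f : C) : A :=
  tensor_lift (@hd_tens C) (fun u v => phi u * psi v) (hd_coprod f).

Definition conv_unit (C : hopf_data) (A : algType rat) (f : C) : A := (hd_counit f)%:A.
Arguments conv_unit : clear implicits.

Section Convolution.
Variables (C : hopf_data) (A : algType rat).
Hypothesis coC : is_coalgebra C.
Implicit Types phi psi chi : C -> A.
Local Notation t := (@hd_tens C).
Let tT := co_tensor coC.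

Lemma conv_bilin phi psi : linear phi -> linear psi ->
  bilinear_map (fun u v : C => phi u * psi v).
Proof. by move=> hl gl; apply: bilin_comp hl gl; exact: mul_bilin. Qed.

Lemma conv_linear phi psi : linear phi -> linear psi -> linear (conv phi psi).
Proof.
move=> hl gl; apply: lin_comp (co_linear coC).
by case: (tensor_liftP tT (conv_bilin hl gl)).
Qed.

Lemma conv_unit_linear : linear (conv_unit C A).
Proof.
by move=> k u v; rewrite /conv_unit (co_counit_linear coC) scalerDl -scalerA.
Qed.

(** This replaces Sweedler notation: any expression of the coproduct by pure tensors computes the
    convolution. *)
Lemma conv_sumE phi psi f (s : seq (C * C)) : linear phi -> linear psi ->
  hd_coprod f = \sum_(x <- s) t x.1 x.2 ->
  conv phi psi f = \sum_(x <- s) phi x.1 * psi x.2.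
Proof. by move=> hl gl fs; rewrite /conv fs tensor_lift_sum //; exact: conv_bilin. Qed.

(** The antipode laws are phrased with [tensor_map]; this turns them into identities between
    convolutions. *)
Lemma mult_tensor_map phi psi (S S' : C -> C) f :
  linear phi -> linear psi -> linear S -> linear S' ->
  tensor_lift t (fun u v => phi u * psi v) (tensor_map t t S S' (hd_coprod f)) =
  conv (phi \o S) (psi \o S') f.
Proof.
move=> hl gl sl sl'; rewrite /conv.
have [l1 e1] := tensor_liftP tT (conv_bilin hl gl).
have [l2 e2] := tensor_liftP tT (bilin_comp (tensor_bilin tT) sl sl').
have [l3 e3] := tensor_liftP tT (conv_bilin (lin_comp hl sl) (lin_comp gl sl')).
apply: (tensor_ext tT (h := tensor_lift t (fun u v => phi u * psi v) \o _) _ l3).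
  exact: lin_comp l1 l2.
by move=> u v; rewrite /= /tensor_map e2 e1 e3.
Qed.

(** Both sides factor through one map [K] on the tensor cube, the product [phi u * psi v * chi w],
    and coassociativity identifies its two arguments. *)
Lemma convA phi psi chi : linear phi -> linear psi -> linear chi ->
  conv (conv phi psi) chi =1 conv phi (conv psi chi).
Proof.
move=> pl ql rl f; have Dl := co_linear coC.
have lid : linear (id : C -> C) by [].
have [l1 e1] := tensor_liftP tT (conv_bilin pl ql).
have [l2 e2] := tensor_liftP tT (conv_bilin ql rl).
have [l3 e3] := tensor_liftP (co_tensor21 coC) (bilin_comp (@mul_bilin A) l1 rl).
set K := tensor_lift _ _ in l3 e3.
have [l4 e4] := tensor_liftP tT (bilin_comp (tensor_bilin (co_tensor21 coC)) Dl lid).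
have [l5 e5] := tensor_liftP tT (bilin_comp (tensor_bilin (co_tensor12 coC)) lid Dl).
have [l6 e6] := tensor_liftP tT (conv_bilin (conv_linear pl ql) rl).
have [l7 e7] := tensor_liftP tT (conv_bilin pl (conv_linear ql rl)).
transitivity (K (tensor_map t (@hd_tens21 C) (@hd_coprod C) id (hd_coprod f))).
  apply: (tensor_ext tT (h' := K \o _) l6) => [|u v]; first exact: lin_comp l3 l4.
  by rewrite /= /tensor_map e4 e6 e3.
rewrite (co_assoc coC); apply/esym.
apply: (tensor_ext tT (h' := K \o _) l7) => [|u v]; first exact: lin_comp l3 l5.
rewrite /= /tensor_map e5 e7.
have [bl _] := tensor_bilin (co_tensor12 coC).
(* [K] is defined through the other bracketing, so its value on [hd_tens12 u x] is found by taking
   pure tensors for [x], which [co_tensorA] rebrackets. *)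
apply/esym; apply: (tensor_ext tT (h := K \o hd_tens12 u)
  (h' := fun x => phi u * tensor_lift t (fun v w => psi v * chi w) x)).
- exact: lin_comp l3 (bl u).
- by move=> k x y; rewrite l2 mulrDr scalerAr.
- by move=> a b; rewrite /= -(co_tensorA coC) e3 e1 e2 mulrA.
Qed.

Lemma conv1l phi : linear phi -> conv (conv_unit C A) phi =1 phi.
Proof.
move=> pl f; rewrite -[in RHS](co_counitl coC f).
have cl := co_counit_linear coC.
have bb : bilinear_map (fun g h : C => hd_counit g *: h).
  split=> [u|v] k x y; first by rewrite scalerDr !scalerA mulrC.
  by rewrite cl scalerDl scalerA.
have [l1 e1] := tensor_liftP tT bb.
have [l2 e2] := tensor_liftP tT (conv_bilin conv_unit_linear pl).
apply: (tensor_ext tT (h' := phi \o _) l2) => [|u v]; first exact: lin_comp pl l1.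
by rewrite e2 /= e1 (linZ pl) mulr_algl.
Qed.

Lemma conv1r phi : linear phi -> conv phi (conv_unit C A) =1 phi.
Proof.
move=> pl f; rewrite -[in RHS](co_counitr coC f).
have cl := co_counit_linear coC.
have bb : bilinear_map (fun g h : C => hd_counit h *: g).
  split=> [u|v] k x y; first by rewrite cl scalerDl scalerA.
  by rewrite scalerDr !scalerA mulrC.
have [l1 e1] := tensor_liftP tT bb.
have [l2 e2] := tensor_liftP tT (conv_bilin pl conv_unit_linear).
apply: (tensor_ext tT (h' := phi \o _) l2) => [|u v]; first exact: lin_comp pl l1.
by rewrite e2 /= e1 (linZ pl) mulr_algr.
Qed.

Lemma eq_conv phi phi' psi psi' : phi =1 phi' -> psi =1 psi' ->
  conv phi psi =1 conv phi' psi'.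
Proof. by move=> /funext -> /funext ->. Qed.

(** As in any monoid, a left inverse equals a right inverse: insert [phi] convolved with [chi] after
    [psi] and reassociate. *)
Lemma conv_inv_uniq phi psi chi : linear phi -> linear psi -> linear chi ->
  conv psi phi =1 conv_unit C A -> conv phi chi =1 conv_unit C A -> psi =1 chi.
Proof.
move=> pl ql rl h1 h2 f.
rewrite -(conv1r ql) -(conv1l rl) -(eq_conv (fun=> erefl) h2) -(eq_conv h1 (fun=> erefl)).
by rewrite convA.
Qed.

End Convolution.

Lemma antipodeP (H : hopf_data) (S : H -> H) : is_coalgebra H -> linear S ->
  (is_antipode S <-> conv S id =1 conv_unit H H /\ conv id S =1 conv_unit H H).
Proof.
move=> coH Sl; have lid : linear (id : H -> H) by [].
have E1 f := mult_tensor_map coH f lid lid Sl lid.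
have E2 f := mult_tensor_map coH f lid lid lid Sl.
split=> [[_ h1 h2]|[h1 h2]]; first by split=> f;
  [exact: etrans (esym (E1 f)) (h1 f) | exact: etrans (esym (E2 f)) (h2 f)].
by split=> // f; [apply: etrans (E1 f) (h1 f)|apply: etrans (E2 f) (h2 f)].
Qed.

(** * Antipodes from a connected grading *)

Section GradedConnected.
Variable H : hopf_data.
Hypothesis coH : is_coalgebra H.
Hypothesis H_deg : is_grading (@hd_deg H).
Hypothesis H_deg_coprod : forall n (f : H), hd_deg n f ->
  exists s : seq (H * H), hd_coprod f = \sum_(x <- s) hd_tens x.1 x.2 /\
    forall x, x \in s -> exists i j, [/\ (i + j)%N = n, hd_deg i x.1 & hd_deg j x.2].
Hypothesis H_counit1 : hd_counit (1 : H) = 1.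
Hypothesis H_connected : is_connected H.
Hypothesis H_deg1 : hd_deg 0 (1 : H).

(* The antipode is the geometric series of the powers of aug, which are locally
   nilpotent because aug kills the degree 0. *)
Definition aug (f : H) : H := f - conv_unit H H f.
Fixpoint aug_pow (k : nat) : H -> H :=
  if k is k'.+1 then conv (aug_pow k') aug else conv_unit H H.
Definition aug_sum (N : nat) (f : H) : H := \sum_(k < N) (-1) ^+ k *: aug_pow k f.

Let u_lin : linear (conv_unit H H) := conv_unit_linear H coH.

Let id_lin : linear (id : H -> H). Proof. by []. Qed.

Lemma aug_linear : linear aug.
Proof. exact: (lin_add id_lin (lin_opp u_lin)). Qed.

Lemma aug_pow_linear k : linear (aug_pow k).
Proof. by elim: k => // k IH; apply: conv_linear; last exact: aug_linear. Qed.

Lemma aug_sum_linear N : linear (aug_sum N).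
Proof.
by apply: lin_sum_of => k; apply: lin_scale; exact: aug_pow_linear.
Qed.

(** The recursion adds the new factor on the right. Having it on the left as well gives the second
    antipode law. *)
Lemma aug_powS k : aug_pow k.+1 =1 conv aug (aug_pow k).
Proof.
elim: k => [|k IH] f.
  by rewrite /= conv1l ?conv1r //; exact: aug_linear.
have al := aug_linear; have pl := aug_pow_linear.
by rewrite /= (eq_conv IH (fun=> erefl)) convA.
Qed.

Lemma aug_deg0 f : hd_deg 0 f -> aug f = 0.
Proof.
have [e e0 eP] := H_connected.
(* Connectedness provides an unspecified generator [e] of degree 0; as 1 is a nonzero multiple of
   it, 1 is a generator too. *)
have [k1 one_e] := (eP 1).1 H_deg1.
have k10 : k1 != 0.
  by apply: contraTneq (oner_neq0 H) => k10; rewrite one_e k10 scale0r eqxx.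
move=> /eP[k ->]; have eE : e = k1^-1 *: 1 by rewrite one_e scalerA mulVf // scale1r.
rewrite (linZ aug_linear) eE (linZ aug_linear) /aug /conv_unit H_counit1 scale1r subrr.
by rewrite !scaler0.
Qed.

(** In each term of the coproduct, either the right factor has degree 0 and [aug] kills it, or the
    left factor has smaller degree and induction applies. *)
Lemma aug_pow_deg k n f : hd_deg n f -> (n < k)%N -> aug_pow k f = 0.
Proof.
elim: k n f => // k IH n f nf nk.
have [s [fs sdeg]] := H_deg_coprod nf.
rewrite /= (conv_sumE coH (aug_pow_linear k) aug_linear fs) big_seq big1 // => x xs.
have [i [[|j] [ij xi xj]]] := sdeg x xs; first by rewrite (aug_deg0 xj) mulr0.
by rewrite (IH i) ?mul0r // -ltnS (leq_trans _ nk) // -ij addnS !ltnS leq_addr.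
Qed.

Lemma aug_pow_nilp f : exists N, forall k, (N <= k)%N -> aug_pow k f = 0.
Proof.
have [_ /(_ f)[N [c [cdeg ->]]] _] := H_deg.
exists N => k Nk; rewrite (lin_sum (aug_pow_linear k)) big1 // => i _.
by apply: aug_pow_deg (cdeg i) _; apply: leq_trans Nk.
Qed.

(** [F] stands for convolution with the identity, on either side, evaluated at [f]; the alternating
    sum telescopes. *)
Lemma aug_sumE (N : nat) (F : (H -> H) -> H) f :
  (forall k, F (aug_pow k) = aug_pow k f + aug_pow k.+1 f) ->
  \sum_(k < N) (-1) ^+ k *: F (aug_pow k) = conv_unit H H f - (-1) ^+ N *: aug_pow N f.
Proof.
move=> FE; under eq_bigr do rewrite FE.
elim: N => [|N IH]; first by rewrite big_ord0 expr0 scale1r subrr.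
rewrite big_ord_recr /= {}IH scalerDr exprS mulN1r scaleNr opprK.
by rewrite addrA subrK.
Qed.

(** The identity is [conv_unit] plus [aug], so the truncated geometric series inverts it up to the
    power [aug_pow N], which vanishes at [f]. *)
Lemma conv_aug_sum N f (s : seq (H * H)) : hd_coprod f = \sum_(x <- s) hd_tens x.1 x.2 ->
  aug_pow N f = 0 ->
  conv (aug_sum N) id f = conv_unit H H f /\ conv id (aug_sum N) f = conv_unit H H f.
Proof.
move=> fs fN; have al := aug_linear; have pl := aug_pow_linear.
have E (h : H) : h = conv_unit H H h + aug h by rewrite addrC subrK.
have <- : conv_unit H H f - (-1) ^+ N *: aug_pow N f = conv_unit H H f.
  by rewrite fN scaler0 subr0.
have sl := aug_sum_linear N.
rewrite !(conv_sumE coH _ _ fs) //.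
split.
  rewrite -(@aug_sumE N (fun phi => \sum_(x <- s) phi x.1 * x.2)); last first.
    move=> k; rewrite -(conv1r coH (pl k) f) (conv_sumE coH (pl k) u_lin fs).
    rewrite /= (conv_sumE coH (pl k) al fs) -big_split /=; apply: eq_bigr => x _.
    by rewrite -mulrDr -E.
  under eq_bigr do rewrite mulr_suml; rewrite exchange_big; apply: eq_bigr => k _.
  by rewrite scaler_sumr; apply: eq_bigr => x _; rewrite scalerAl.
rewrite -(@aug_sumE N (fun phi => \sum_(x <- s) x.1 * phi x.2)); last first.
  move=> k; rewrite aug_powS -{1}(conv1l coH (pl k) f) (conv_sumE coH u_lin (pl k) fs).
  rewrite (conv_sumE coH al (pl k) fs) -big_split /=; apply: eq_bigr => x _.
  by rewrite -mulrDl -E.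
under eq_bigr do rewrite mulr_sumr; rewrite exchange_big; apply: eq_bigr => k _.
by rewrite scaler_sumr; apply: eq_bigr => x _; rewrite scalerAr.
Qed.

Lemma graded_connected_antipode : exists S, @is_antipode H S.
Proof.
have /choice[N NP] := aug_pow_nilp.
(* The truncation depends on [f], but by [SE] every longer one gives the same value; linearity is
   then checked at a common bound. *)
pose S f := aug_sum (N f) f.
have SE n f : (N f <= n)%N -> S f = aug_sum n f.
  move=> fn; rewrite /S /aug_sum -!(big_mkord xpredT (fun k => (-1) ^+ k *: aug_pow k f)).
  rewrite [RHS](big_cat_nat (n := N f)) //= [X in _ + X]big1_seq ?addr0 // => k.
  by rewrite mem_index_iota => /andP[_ /andP[/NP -> _]]; rewrite scaler0.
have Sl : linear S.
  move=> k f g; pose M := maxn (N (k *: f + g)) (maxn (N f) (N g)).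
  rewrite !(SE M) ?leq_max ?leqnn ?orbT //; exact: aug_sum_linear.
exists S; apply/(antipodeP coH Sl).
(* Homogeneous elements come first, since their coproduct is given as a sum of pure tensors; the
   rest follows by linearity. *)
have key n f : hd_deg n f -> conv S id f = conv_unit H H f /\ conv id S f = conv_unit H H f.
  move=> /H_deg_coprod[s [fs _]].
  (* [M] serves [f] and all factors in its coproduct, so that [S] can be replaced by the single map
     [aug_sum M]. *)
  pose M := maxn (N f) (\max_(x <- s) maxn (N x.1) (N x.2)).
  have fM : aug_pow M f = 0 by apply: NP; rewrite leq_maxl.
  have sM x : x \in s -> (N x.1 <= M)%N && (N x.2 <= M)%N.
    move=> xs; rewrite -geq_max leq_max; apply/orP; right.
    exact: (leq_bigmax_seq (F := fun x => maxn (N x.1) (N x.2))).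
  have [E1 E2] := conv_aug_sum fs fM; have sl := aug_sum_linear M.
  rewrite -{1}E1 -E2 !(conv_sumE coH _ _ fs) //.
  by split; apply: eq_big_seq => x /sM/andP[? ?]; rewrite (SE M).
have [_ dec _] := H_deg.
have lid : linear (id : H -> H) by [].
split=> f; have [n [c [cdeg ->]]] := dec f.
  rewrite (lin_sum (conv_linear coH Sl lid)) (lin_sum u_lin).
  by apply: eq_bigr => i _; case: (key _ _ (cdeg i)).
rewrite (lin_sum (conv_linear coH lid Sl)) (lin_sum u_lin).
by apply: eq_bigr => i _; case: (key _ _ (cdeg i)).
Qed.

End GradedConnected.

(** [i \o SB] is a left and [SA \o i] a right convolution inverse of [i] among linear maps from [B]
    to [A]. *)
Lemma bialgebra_map_antipode (B A : hopf_data) (i : B -> A) SB SA :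
  is_coalgebra B -> is_coalgebra A -> linear i -> i 1 = 1 -> {morph i : f g / f * g} ->
  (forall f, hd_coprod (i f) = tensor_map (@hd_tens B) (@hd_tens A) i i (hd_coprod f)) ->
  (forall f, hd_counit (i f) = hd_counit f) ->
  is_antipode SB -> is_antipode SA -> forall f, i (SB f) = SA (i f).
Proof.
move=> coB coA il i1 iM iD ie aB aA.
have [SBl _ _] := aB; have [SAl _ _] := aA.
have [bB _] := (antipodeP coB SBl).1 aB; have [_ bA] := (antipodeP coA SAl).1 aA.
have lidB : linear (id : B -> B) by []. have lidA : linear (id : A -> A) by [].
apply: (@conv_inv_uniq _ _ coB i (i \o SB) (SA \o i)) => //.
- exact: lin_comp il SBl.
- exact: lin_comp SAl il.
- move=> f; rewrite /conv_unit -i1 -(linZ il); apply: etrans (congr1 i (bB f)).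
  have [l1 e1] := tensor_liftP (co_tensor coB) (conv_bilin SBl lidB).
  have [l2 e2] := tensor_liftP (co_tensor coB) (conv_bilin (lin_comp il SBl) il).
  apply: (tensor_ext (co_tensor coB) (h' := i \o _) l2); first exact: lin_comp il l1.
  by move=> u v; rewrite e2 /= e1 iM.
- move=> f; rewrite /conv_unit -ie; apply: etrans (bA (i f)).
  rewrite /conv iD.
  have [l1 e1] := tensor_liftP (co_tensor coA) (conv_bilin lidA SAl).
  have [l2 e2] := tensor_liftP (co_tensor coB) (conv_bilin il (lin_comp SAl il)).
  have [l3 e3] := tensor_liftP (co_tensor coB)
    (bilin_comp (tensor_bilin (co_tensor coA)) il il).
  apply: (tensor_ext (co_tensor coB) (h' := _ \o tensor_map _ _ i i) l2).
    exact: lin_comp l1 l3.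
  by move=> u v; rewrite e2; apply/esym/(etrans (congr1 _ (e3 u v)))/e1.
Qed.

(** * Monomials and series *)

Section Supercommutativity.
Context {d : Order.disp_t} {I : orderType d}.
Implicit Types (a b m : mono I) (f g : series I).

Lemma tdeg_size m : tdeg m = size (tsupp m).
Proof.
have -> : size (tsupp m) = size [seq i <- finsupp m | (m i).1].
  apply/perm_size/uniq_perm; rewrite ?filter_uniq ?fset_uniq // => i.
  by rewrite inE mem_filter andbC.
by rewrite size_filter -sum1_count big_mkcond; apply: eq_bigr => i _; case: (m i).1.
Qed.

Lemma xdeg_mmul a b : xdeg (mmul a b) = (xdeg a + xdeg b)%N.
Proof.
have E c : (finsupp c `<=` finsupp (mmul a b))%fset ->
    xdeg c = (\sum_(i <- finsupp (mmul a b)) (c i).2)%N.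
  by move=> cm; apply: big_fset_incl => // i _ /fsfun_dflt ->.
rewrite (E a) ?finsupp_mmull // (E b) ?finsupp_mmulr // -big_split /=.
by apply: eq_bigr => i _; rewrite mmulE.
Qed.

(** A repeated theta would count once on the left and twice on the right; the nonzero sign excludes
    it. *)
Lemma tdeg_mmul a b : msign a b != 0 -> tdeg (mmul a b) = (tdeg a + tdeg b)%N.
Proof.
have [/fdisjointP dab _|/msign_dis->] := boolP [disjoint tsupp a & tsupp b]%fset;
  last by rewrite eqxx.
have E c : (finsupp c `<=` finsupp (mmul a b))%fset ->
    tdeg c = (\sum_(i <- finsupp (mmul a b)) (c i).1)%N.
  by move=> cm; apply: big_fset_incl => // i _ /fsfun_dflt ->.
rewrite (E a) ?finsupp_mmull // (E b) ?finsupp_mmulr // -big_split /=.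
apply: eq_bigr => i _; rewrite mmulE; have := dab i; rewrite !in_tsupp.
by case: (a i).1 => [/(_ isT)/negbTE->|].
Qed.

(** Each pair of a theta of [a] and a theta of [b] contributes one factor -1. If a theta is shared,
    both signs are 0. *)
Lemma msignC a b : msign b a = (-1) ^+ (tdeg a * tdeg b) * msign a b.
Proof.
have [dab|nab] := boolP [disjoint tsupp a & tsupp b]%fset; last first.
  by rewrite (msign_dis nab) msign_dis ?mulr0 // fdisjoint_sym.
have const (s : seq I) (x : rat) : \prod_(i <- s) x = x ^+ size s.
  by rewrite big_const_seq count_predT -Monoid.iteropE.
rewrite [in LHS]/msign exchange_big /= !tdeg_size mulnC exprM -const -big_split /=.
apply: eq_big_seq => i ia; rewrite -const -big_split /=; apply: eq_big_seq => j jb.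
have ij : i != j by apply: contraTneq ia => ->; apply: contraTN jb => /(fdisjointP dab).
rewrite /tsgn eq_sym (negbTE ij) mulN1r.
by have [_|_|E] := ltgtP i j; rewrite ?opprK //; rewrite E eqxx in ij.
Qed.

Lemma smulC p q f g : (forall m, f m != 0 -> tdeg m = p) ->
  (forall m, g m != 0 -> tdeg m = q) -> f * g = (-1) ^+ (p * q) *: (g * f).
Proof.
move=> fp gq; apply/funext => m.
rewrite [RHS](_ : _ = (-1) ^+ (p * q) * (g * f) m) // !smulE mulr_fsumr.
rewrite (reindex_fsbig (fun x => (x.2, x.1)) [set x | mmul x.1 x.2 = m]).
  apply: eq_fsbigr => -[b a] _ /=; rewrite [g b * f a]mulrC.
  have [->|/fp <-] := eqVneq (f a) 0; first by rewrite !(mul0r, mulr0).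
  have [->|/gq <-] := eqVneq (g b) 0; first by rewrite !(mul0r, mulr0).
  by rewrite (msignC b a) mulnC -!mulrA.
have mmulC (a b : mono I) : mmul a b = mmul b a.
  by apply/fsfunP => i; rewrite !mmulE orbC addnC.
split=> [[b a] /=|[b a] [b' a'] _ _ /= [-> ->] //|[a b] /= abm].
  by rewrite mmulC.
by exists (b, a) => //=; rewrite mmulC.
Qed.

End Supercommutativity.

Section Push.
Context {d d' : Order.disp_t} {I : orderType d} {J : orderType d'}.
Variable e : I -> J.

Lemma xdeg_push m : {in finsupp m &, injective e} -> xdeg (push e m) = xdeg m.
Proof.
move=> einj; rewrite /xdeg finsupp_push // big_imfset //=.
by apply: eq_big_seq => i im; rewrite (pushE einj).
Qed.

Lemma tdeg_push m : {in finsupp m &, injective e} -> tdeg (push e m) = tdeg m.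
Proof.
move=> einj; rewrite /tdeg finsupp_push // big_imfset //=.
by apply: eq_big_seq => i im; rewrite (pushE einj).
Qed.

Lemma push_injE m i : injective e -> push e m (e i) = m i.
Proof.
move=> einj; apply: (pushE (D := (i |` finsupp m)%fset)) => [v w _ _||].
- exact: einj.
- exact: fsubsetU1.
- by rewrite in_fset1U eqxx.
Qed.

Lemma msign_push a b : {in finsupp (mmul a b) &, {homo e : i j / (i < j)%O}} ->
  msign (push e a) (push e b) = msign a b.
Proof.
move=> eh; have sub c : (finsupp c `<=` finsupp (mmul a b))%fset ->
    {in finsupp c &, {homo e : i j / (i < j)%O}}.
  by move=> /fsubsetP cm i j /cm + /cm; apply: eh.
have := nsgn_mul (incr_inj eh); rewrite !nsgn_mono //.
- by rewrite !mulr1 mul1r.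
- exact/sub/finsupp_mmulr.
- exact/sub/finsupp_mmull.
Qed.

End Push.

Lemma push_id d (I : orderType d) (m : mono I) : push id m = m.
Proof. by apply/esym/push_uniq => [//|//|i im]; exists i. Qed.

Lemma comp_push p q (r : vars p -> vars q) m :
  {in finsupp m &, {homo r : v w / (v < w)%O}} -> comp (push r m) = comp m.
Proof.
move=> rh; rewrite /comp msupp_push // -map_comp; apply/eq_in_map => v.
by rewrite mem_msupp => vm /=; rewrite (pushE (incr_inj rh)).
Qed.

(** [comp_mono (comp m)] is [m] relabelled by the ranks of its variables, which is increasing. *)
Lemma comp_comp_mono n (m : mono (vars n)) : comp (comp_mono (comp m)) = comp m.
Proof. by rewrite comp_monoE comp_push //; exact: rank_homo. Qed.

Lemma xdeg_comp n (m : mono (vars n)) : xdeg m = (\sum_(x <- comp m) x.2)%N.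
Proof. by rewrite big_map; apply: perm_big; rewrite perm_sym perm_sort. Qed.

Lemma tdeg_comp n (m : mono (vars n)) : tdeg m = (\sum_(x <- comp m) x.1)%N.
Proof. by rewrite big_map; apply: perm_big; rewrite perm_sym perm_sort. Qed.

Lemma comp0 n (m : mono (vars n)) : (comp m == [::]) = (m == mono1).
Proof.
apply/eqP/eqP => [/(congr1 size)|->]; last first.
  by rewrite /comp /msupp finsupp0.
rewrite /comp size_map => /size0nil m0; apply/fsfunP => v; rewrite mono1E.
by apply: fsfun_dflt; rewrite -mem_msupp m0.
Qed.

Lemma quasisymmetric_compE (f : series (vars 1)) : quasisymmetric f ->
  forall m m', comp m = comp m' -> f m = f m'.
Proof.
move=> fq m m' mm'; apply: fq => k.
have E (m0 : mono (vars 1)) : bcomp k m0 = comp m0.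
  by rewrite /bcomp (@eq_in_filter _ _ predT) ?filter_predT // => v _; rewrite !ord1 eqxx.
by rewrite !E.
Qed.

Section Rename.
Variables (p q : nat) (g : 'I_p -> 'I_q).

Hypothesis gh : {homo g : i j / (i < j)%O}.
Let ginj := @rename_var_inj _ _ _ gh.

Lemma pull_push m : pull g (push (rename_var g) m) = m.
Proof. by apply/fsfunP => v; rewrite pullE push_injE. Qed.

Lemma rename_push f m : rename_sets g f (push (rename_var g) m) = f m.
Proof.
rewrite /rename_sets pull_push; case: ifPn => // /allPn[w].
rewrite finsupp_push; last by move=> ? ? _ _; apply: ginj.
by case/imfsetP => /= v _ ->; rewrite codom_f.
Qed.

Lemma rename_supp f m : rename_sets g f m != 0 ->
  m = push (rename_var g) (pull g m) /\ f (pull g m) != 0.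
Proof. by rewrite /rename_sets; case: ifP => [/(push_pull gh)|_]; rewrite ?eqxx. Qed.

Lemma rename_tdeg f n : (forall m, f m != 0 -> tdeg m = n) ->
  forall m, rename_sets g f m != 0 -> tdeg m = n.
Proof.
move=> fn m /rename_supp[mE /fn <-]; rewrite {1}mE tdeg_push //.
by move=> ? ? _ _; apply: ginj.
Qed.

Lemma rename_mul f h : rename_sets g (f * h) = rename_sets g f * rename_sets g h.
Proof.
apply/funext => m.
have [mg|mg] := boolP (all (fun w : vars q => w.1 \in codom g) (finsupp m)).
  rewrite (push_pull gh mg) rename_push mul_push; last by move=> ? ? _ _; apply: ginj.
  rewrite smulE; apply: eq_fsbigr => -[a b] _ /=.
  by rewrite !rename_push msign_push // => v w _ _; apply: rename_var_homo.
(* A variable of [m] outside the image of [g] occurs in a factor of every factorization, and the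
   renamed series vanishes at that factor. *)
rewrite [LHS]/rename_sets (negbTE mg) smulE fsbig1 // => -[a b] /= abm.
apply/eqP; apply: contraNT mg; rewrite !mulf_eq0 !negb_or => /and3P[_ + +].
rewrite /rename_sets; case: ifP => [/allP ag _|_]; last by rewrite eqxx.
case: ifP => [/allP bg _|_]; last by rewrite eqxx.
apply/allP => w; rewrite -abm mem_finsupp mmulE.
have [wa _|/fsfun_dflt->] := boolP (w \in finsupp a); first exact: ag.
have [wb _|/fsfun_dflt->] := boolP (w \in finsupp b); first exact: bg.
by rewrite eqxx.
Qed.

End Rename.

Lemma eval_sets1 n : eval_sets (1 : series (vars 1)) = (1 : series (vars n)).
Proof.
apply/funext => m; rewrite /eval_sets /GRing.one /= /sone -!comp0 comp_comp_mono //.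
Qed.

(** Relabelling by [rank m] matches the factorizations of [m] with those of its image and, being
    increasing, keeps their signs; the coefficients of the factors only depend on compositions. *)
Lemma eval_setsM n (f g : series (vars 1)) : quasisymmetric f -> quasisymmetric g ->
  eval_sets (f * g) = eval_sets f * eval_sets g :> series (vars n).
Proof.
move=> fq gq; apply/funext => m; have rh := @rank_homo n m.
rewrite /eval_sets comp_monoE mul_push; last exact: incr_inj.
rewrite smulE; apply: eq_fsbigr => -[a b] /set_mem/= abm.
have sub c : (finsupp c `<=` finsupp m)%fset ->
    {in finsupp c &, {homo rank m : i j / (i < j)%O}}.
  by move=> /fsubsetP cm i j /cm + /cm; apply: rh.
have am : (finsupp a `<=` finsupp m)%fset by rewrite -abm finsupp_mmull.
have bm : (finsupp b `<=` finsupp m)%fset by rewrite -abm finsupp_mmulr.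
rewrite msign_push ?abm //; congr (_ * (_ * _)).
  by apply: (quasisymmetric_compE fq); rewrite comp_comp_mono comp_push //; apply: sub.
by apply: (quasisymmetric_compE gq); rewrite comp_comp_mono comp_push //; apply: sub.
Qed.

(** * Concatenation of alphabets *)

Section Join.
Variables p q : nat.
Local Notation lv := (rename_var (@lshift p q)).
Local Notation rv := (rename_var (@rshift p q)).
Local Notation pl := (pull (@lshift p q)).
Local Notation pr := (pull (@rshift p q)).
Implicit Types (a : mono (vars p)) (b : mono (vars q)) (m : mono (vars (p + q))).

Definition join a b : mono (vars (p + q)) := mmul (push lv a) (push rv b).

Let lv_homo := rename_var_homo (@lshift_homo p q).
Let rv_homo := rename_var_homo (@rshift_homo p q).
Let lv_inj := rename_var_inj (@lshift_homo p q).
Let rv_inj := rename_var_inj (@rshift_homo p q).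

Lemma vars_split (w : vars (p + q)) : (exists v, w = lv v) \/ (exists v, w = rv v).
Proof.
case: w => k i; rewrite -(fintype.splitK k); case: (fintype.split k) => j /=.
  by left; exists ((j, i) : vars p).
by right; exists ((j, i) : vars q).
Qed.

Lemma lv_rv v w : lv v <> rv w.
Proof. by move/(congr1 fst) => /= /eqP; rewrite eq_lrshift. Qed.

Lemma lv_lt_rv v w : (lv v < rv w)%O.
Proof.
have h : ((lv v).1 < (rv w).1)%O.
  by rewrite ltEord /=; apply: leq_trans (ltn_ord _) (leq_addr _ _).
by rewrite ltEprodlexi (ltW h) leNgt h.
Qed.

Lemma joinl a b v : join a b (lv v) = a v.
Proof.
rewrite mmulE push_injE // pushN ?orbF ?addn0 -?surjective_pairing //.
by move=> w _ /esym; exact: lv_rv.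
Qed.

Lemma joinr a b v : join a b (rv v) = b v.
Proof.
rewrite mmulE push_injE // [push lv a _]pushN -?surjective_pairing // => w _.
exact: lv_rv.
Qed.

Lemma pull_joinl a b : pl (join a b) = a.
Proof. by apply/fsfunP => v; rewrite pullE joinl. Qed.

Lemma pull_joinr a b : pr (join a b) = b.
Proof. by apply/fsfunP => v; rewrite pullE joinr. Qed.

Lemma joinK m : join (pl m) (pr m) = m.
Proof.
apply/fsfunP => w; case: (vars_split w) => -[v ->].
  by rewrite joinl pullE.
by rewrite joinr pullE.
Qed.

Lemma join1 : join mono1 mono1 = mono1.
Proof. by rewrite /join !push1 mmul1m. Qed.

Lemma join_eq1 m : (m == mono1) = (pl m == mono1) && (pr m == mono1).
Proof.
apply/eqP/andP => [->|[/eqP lm /eqP rm]]; last by rewrite -(joinK m) lm rm join1.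
by rewrite -join1 pull_joinl pull_joinr.
Qed.

Lemma mem_joinl a b v : (lv v \in finsupp (join a b)) = (v \in finsupp a).
Proof. by rewrite !mem_finsupp joinl. Qed.

Lemma mem_joinr a b v : (rv v \in finsupp (join a b)) = (v \in finsupp b).
Proof. by rewrite !mem_finsupp joinr. Qed.

(** All thetas of the left alphabet precede those of the right one, so nothing is reordered. This is
    why coefficients of [tensor] carry no sign. *)
Lemma msign_lr a b : msign (push lv a) (push rv b) = 1.
Proof.
rewrite /msign !tsupp_push; try by move=> ? ? _ _; first [apply: lv_inj|apply: rv_inj].
rewrite big_seq big1 // => _ /imfsetP[/= v _ ->].
rewrite big_seq big1 // => _ /imfsetP[/= w _ ->].
by have h := lv_lt_rv v w; rewrite /tsgn (lt_eqF h) (lt_gtF h).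
Qed.

(** Only one factorization of [m] has its left factor in the first alphabet and its right factor in
    the second. *)
Lemma mul_renameE f g m :
  (rename_sets (@lshift p q) f * rename_sets (@rshift p q) g) m = f (pl m) * g (pr m).
Proof.
rewrite smulE -(fsbig_widen [set (push lv (pl m), push rv (pr m))]).
- rewrite fsbig_set1 /= msign_lr mul1r.
  by rewrite (rename_push (@lshift_homo p q)) (rename_push (@rshift_homo p q)).
- by move=> _ -> /=; exact: joinK.
- move=> [a b] [/= abm nab]; apply/eqP; apply: contrapT => /negP.
  rewrite !mulf_eq0 !negb_or => /and3P[_ fa gb]; apply: nab.
  have [aE _] := rename_supp (@lshift_homo p q) fa.
  have [bE _] := rename_supp (@rshift_homo p q) gb.
  have mE : m = join (pl a) (pr b) by rewrite /join -aE -bE.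
  by rewrite mE pull_joinl pull_joinr -aE -bE.
Qed.

Lemma msupp_join m : msupp m = map lv (msupp (pl m)) ++ map rv (msupp (pr m)).
Proof.
apply: (irr_sorted_eq lt_trans ltxx); first exact: msupp_lt.
  rewrite (sorted_pairwise lt_trans) pairwise_cat; apply/and3P; split.
  - by apply/allrelP => _ _ /mapP[v _ ->] /mapP[w _ ->]; exact: lv_lt_rv.
  - by rewrite -(sorted_pairwise lt_trans); exact: (homo_sorted lv_homo _ (msupp_lt _)).
  - by rewrite -(sorted_pairwise lt_trans); exact: (homo_sorted rv_homo _ (msupp_lt _)).
move=> w; rewrite mem_msupp mem_cat; case: (vars_split w) => -[v ->].
  rewrite mem_map // mem_msupp mem_pull; case: mapP => [[u _ /lv_rv] //|_].
  by rewrite orbF.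
rewrite orbC mem_map // mem_msupp mem_pull; case: mapP => [[u _ /esym/lv_rv] //|_].
by rewrite orbF.
Qed.

(** Coassociativity and the counit laws rest on this: concatenation is associative and has the empty
    composition as unit. *)
Lemma comp_join m : Defs.comp m = Defs.comp (pl m) ++ Defs.comp (pr m).
Proof.
rewrite /Defs.comp msupp_join map_cat -!map_comp.
by congr (_ ++ _); apply: eq_map => v; rewrite /= pullE.
Qed.

Lemma comp_joinE a b : Defs.comp (join a b) = Defs.comp a ++ Defs.comp b.
Proof. by rewrite comp_join pull_joinl pull_joinr. Qed.

Lemma xdeg_join m : xdeg m = (xdeg (pl m) + xdeg (pr m))%N.
Proof. by rewrite !xdeg_comp comp_join big_cat. Qed.

Lemma tdeg_join m : tdeg m = (tdeg (pl m) + tdeg (pr m))%N.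
Proof. by rewrite !tdeg_comp comp_join big_cat. Qed.

(** The two alphabets are relabelled independently. Taking the identity on one of them transfers
    invariance to slices. *)
Definition join_fun (e1 : vars p -> vars p) (e2 : vars q -> vars q)
    (w : vars (p + q)) : vars (p + q) :=
  match fintype.split w.1 with
  | inl k => lv (e1 (k, w.2))
  | inr k => rv (e2 (k, w.2))
  end.

Section JoinFun.
Variables (e1 : vars p -> vars p) (e2 : vars q -> vars q).
Local Notation e := (join_fun e1 e2).

Lemma join_funl v : e (lv v) = lv (e1 v).
Proof.
by rewrite /join_fun /= -[lshift q v.1]/(unsplit (inl v.1)) unsplitK -surjective_pairing.
Qed.

Lemma join_funr v : e (rv v) = rv (e2 v).
Proof.
by rewrite /join_fun /= -[rshift p v.1]/(unsplit (inr v.1)) unsplitK -surjective_pairing.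
Qed.

Lemma join_fun_inj a b : {in finsupp a &, injective e1} -> {in finsupp b &, injective e2} ->
  {in finsupp (join a b) &, injective e}.
Proof.
move=> i1 i2 v w; case: (vars_split v) (vars_split w) => -[v' ->] [] [w' ->].
- by rewrite !mem_joinl !join_funl => va wa /lv_inj/i1 ->.
- by rewrite join_funl join_funr => _ _ /lv_rv.
- by rewrite join_funl join_funr => _ _ /esym/lv_rv.
- by rewrite !mem_joinr !join_funr => vb wb /rv_inj/i2 ->.
Qed.

Lemma push_join a b : {in finsupp a &, injective e1} -> {in finsupp b &, injective e2} ->
  push e (join a b) = join (push e1 a) (push e2 b).
Proof.
move=> i1 i2; apply/esym/push_uniq => [|v|w].
- exact: join_fun_inj.
- case: (vars_split v) => -[v' ->].
    by rewrite mem_joinl join_funl !joinl => va; rewrite (pushE i1).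
  by rewrite mem_joinr join_funr !joinr => vb; rewrite (pushE i2).
- case: (vars_split w) => -[w' ->].
    rewrite mem_joinl finsupp_push // => /imfsetP[/= v va ->].
    by exists (lv v); rewrite ?mem_joinl ?join_funl.
  rewrite mem_joinr finsupp_push // => /imfsetP[/= v vb ->].
  by exists (rv v); rewrite ?mem_joinr ?join_funr.
Qed.

(** No theta of one alphabet passes a theta of the other: both cross signs in [nsgn_mul] are 1 by
    [msign_lr]. *)
Lemma nsgn_join a b : {in finsupp a &, injective e1} -> {in finsupp b &, injective e2} ->
  nsgn e (join a b) = nsgn e1 a * nsgn e2 b.
Proof.
move=> i1 i2; have einj := join_fun_inj i1 i2.
have El : {in finsupp a, e \o lv =1 lv \o e1} by move=> v _; rewrite /= join_funl.
have Er : {in finsupp b, e \o rv =1 rv \o e2} by move=> v _; rewrite /= join_funr.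
have lI : {in finsupp a &, injective lv} by move=> ? ? _ _; apply: lv_inj.
have rI : {in finsupp b &, injective rv} by move=> ? ? _ _; apply: rv_inj.
have Pl : push e (push lv a) = push lv (push e1 a).
  rewrite push_comp //; last exact: subset_inj (finsupp_mmull _ _) einj.
  rewrite (eq_push _ El) ?push_comp // => [? ? _ _|v w va wa /=]; first exact: lv_inj.
  by rewrite !join_funl => /lv_inj; apply: i1.
have Pr : push e (push rv b) = push rv (push e2 b).
  rewrite push_comp //; last exact: subset_inj (finsupp_mmulr _ _) einj.
  rewrite (eq_push _ Er) ?push_comp // => [? ? _ _|v w va wa /=]; first exact: rv_inj.
  by rewrite !join_funr => /rv_inj; apply: i2.
have := nsgn_mul einj; rewrite Pl Pr !msign_lr mul1r mulr1 => <-.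
have ll : {in finsupp a &, {homo lv : v w / (v < w)%O}} by move=> ? ? _ _; apply: lv_homo.
have rr : {in finsupp b &, {homo rv : v w / (v < w)%O}} by move=> ? ? _ _; apply: rv_homo.
rewrite !nsgn_comp // (eq_nsgn El) (eq_nsgn Er); congr (_ * _).
by apply: (eq_nsgn_comp i2) => ? ? _ _; exact: rv_homo.
Qed.

Lemma adm_incr_join a b : adm_incr a e1 -> adm_incr b e2 -> adm_incr (join a b) e.
Proof.
move=> [b1 i1] [b2 i2]; split=> [v|v w].
  case: (vars_split v) => -[u ->]; rewrite ?mem_joinl ?mem_joinr => us.
    by rewrite join_funl /= b1.
  by rewrite join_funr /= b2.
case: (vars_split v) (vars_split w) => -[v' ->] [] [w' ->].
- rewrite !mem_joinl !join_funl => va wa vw; exact/lv_homo/i1.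
- by rewrite join_funl join_funr => _ _ _; exact: lv_lt_rv.
- by move=> _ _ /lt_gtF; rewrite lv_lt_rv.
- rewrite !mem_joinr !join_funr => va wa vw; apply/rv_homo/i2 => //.
  by move: vw; rewrite (leW_mono (le_mono rv_homo)).
Qed.

Lemma adm_bi_join a b : adm_block_inj a e1 -> adm_block_inj b e2 ->
  adm_block_inj (join a b) e.
Proof.
move=> [b1 i1] [b2 i2]; split; last exact: join_fun_inj.
move=> v; case: (vars_split v) => -[u ->]; rewrite ?mem_joinl ?mem_joinr => us.
  by rewrite join_funl /= b1.
by rewrite join_funr /= b2.
Qed.

End JoinFun.
End Join.

(** * Hopf algebras of series *)

(** These properties, common to quasisymmetric and symmetric series, yield all the Hopf axioms.
    Slices are the columns and rows of the matrix of a series; truncations are its homogeneous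
    components, with [P] general enough for both degrees. *)
Record hopf_family (F : series_family) : Prop := HopfFamily {
  hf_bounded : forall n f, f \in in_family F n -> bounded_degree f;
  hf_quasisymmetric : forall n f, f \in in_family F n -> quasisymmetric f;
  hf_slicel : forall p q (f : series (vars (p + q))) b, f \in in_family F (p + q) ->
    (fun a => f (join a b)) \in in_family F p;
  hf_slicer : forall p q (f : series (vars (p + q))) a, f \in in_family F (p + q) ->
    (fun b => f (join a b)) \in in_family F q;
  hf_truncate : forall n (P : nat -> nat -> bool) f, f \in in_family F n ->
    (fun m => if P (xdeg m) (tdeg m) then f m else 0) \in in_family F n }.

(** * Slices and truncations of quasisymmetric and symmetric series *)

Section FamilyInstances.

Lemma bounded_slicel p q (f : series (vars (p + q))) b :
  bounded_degree f -> bounded_degree (fun a => f (join a b) : rat^o).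
Proof.
move=> [N fN]; exists N => a /fN; rewrite xdeg_join tdeg_join !pull_joinl => h.
by apply: leq_trans h; rewrite leq_add // leq_addr.
Qed.

Lemma bounded_slicer p q (f : series (vars (p + q))) a :
  bounded_degree f -> bounded_degree (fun b => f (join a b) : rat^o).
Proof.
move=> [N fN]; exists N => b /fN; rewrite xdeg_join tdeg_join !pull_joinr => h.
by apply: leq_trans h; rewrite leq_add // leq_addl.
Qed.

Lemma bounded_truncate n (P : nat -> nat -> bool) (f : series (vars n)) :
  bounded_degree f ->
  bounded_degree (fun m => if P (xdeg m) (tdeg m) then f m else 0 : rat^o).
Proof. by move=> [N fN]; exists N => m; case: ifP => [_ /fN|]; rewrite ?eqxx. Qed.

Variable adm : forall n, mono (vars n) -> (vars n -> vars n) -> Prop.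
Hypothesis adm_inj : forall n (m : mono (vars n)) e,
  adm m e -> {in finsupp m &, injective e}.
Hypothesis adm_id : forall n (m : mono (vars n)), adm m id.
Hypothesis adm_join : forall p q e1 e2 (a : mono (vars p)) (b : mono (vars q)),
  adm a e1 -> adm b e2 -> adm (join a b) (join_fun e1 e2).

Let nsgn_id n (m : mono (vars n)) : nsgn id m = 1.
Proof. by apply: nsgn_mono. Qed.

(** A relabelling of the first alphabet is extended by the identity on the second, which adds no
    sign. *)
Lemma invariant_slicel p q (f : series (vars (p + q))) b :
  relabel_invariant adm f -> relabel_invariant adm (fun a => f (join a b) : rat^o).
Proof.
move=> fi a e ae; have idb := adm_id b; have [ai bi] := (adm_inj ae, adm_inj idb).
by rewrite -{1}(push_id b) -push_join // fi ?nsgn_join ?nsgn_id ?mulr1 //; apply: adm_join.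
Qed.

Lemma invariant_slicer p q (f : series (vars (p + q))) a :
  relabel_invariant adm f -> relabel_invariant adm (fun b => f (join a b) : rat^o).
Proof.
move=> fi b e be; have ida := adm_id a; have [bi ai] := (adm_inj be, adm_inj ida).
by rewrite -{1}(push_id a) -push_join // fi ?nsgn_join ?nsgn_id ?mul1r //; apply: adm_join.
Qed.

Lemma invariant_truncate n (P : nat -> nat -> bool) (f : series (vars n)) :
  relabel_invariant adm f ->
  relabel_invariant adm (fun m => if P (xdeg m) (tdeg m) then f m else 0 : rat^o).
Proof.
move=> fi m e me; have mi := adm_inj me; rewrite xdeg_push // tdeg_push //.
by case: ifP => _; rewrite ?mulr0 // fi.
Qed.

End FamilyInstances.

Lemma quasisymmetric_hopf_family : hopf_family quasisymmetric_family.
Proof.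
have adm_id n (m : mono (vars n)) : adm_incr m id by split.
have memP n f : f \in in_family quasisymmetric_family n <->
    bounded_degree f /\ quasisymmetric f.
  by split=> /asboolP.
split=> [n f|n f|||].
- by move=> /memP[].
- by move=> /memP[].
- move=> p q f b /memP[bf /quasisymmetric_inv fi]; apply/memP.
  split; first exact: bounded_slicel.
  exact/quasisymmetric_inv/(invariant_slicel adm_incr_inj adm_id adm_incr_join).
- move=> p q f a /memP[bf /quasisymmetric_inv fi]; apply/memP.
  split; first exact: bounded_slicer.
  exact/quasisymmetric_inv/(invariant_slicer adm_incr_inj adm_id adm_incr_join).
- move=> n P f /memP[bf /quasisymmetric_inv fi]; apply/memP.
  split; first exact: bounded_truncate.
  exact/quasisymmetric_inv/(invariant_truncate adm_incr_inj).
Qed.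

Lemma symmetric_quasisymmetric n (f : series (vars n)) :
  symmetric_series f -> quasisymmetric f.
Proof.
move=> /symmetric_inv fi; apply/quasisymmetric_inv => m e me; apply: fi.
by split; [case: me | exact: adm_incr_inj].
Qed.

Lemma symmetric_hopf_family : hopf_family symmetric_family.
Proof.
have adm_id n (m : mono (vars n)) : adm_block_inj m id by split.
have inj n (m : mono (vars n)) e : adm_block_inj m e -> {in finsupp m &, injective e}.
  by case.
have memP n f : f \in in_family symmetric_family n <->
    bounded_degree f /\ symmetric_series f.
  by split=> /asboolP.
split=> [n f|n f|||].
- by move=> /memP[].
- by move=> /memP[_]; exact: symmetric_quasisymmetric.
- move=> p q f b /memP[bf /symmetric_inv fi]; apply/memP.
  split; first exact: bounded_slicel.
  exact/symmetric_inv/(invariant_slicel inj adm_id adm_bi_join).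
- move=> p q f a /memP[bf /symmetric_inv fi]; apply/memP.
  split; first exact: bounded_slicer.
  exact/symmetric_inv/(invariant_slicer inj adm_id adm_bi_join).
- move=> n P f /memP[bf /symmetric_inv fi]; apply/memP.
  split; first exact: bounded_truncate.
  exact/symmetric_inv/(invariant_truncate inj).
Qed.

(* A degree bound limits both the number and the size of the parts of a dotted
   composition, so that there are finitely many of them. *)
Lemma bounded_representatives n N : exists s : seq (mono (vars n)),
  forall m, (xdeg m + tdeg m <= N)%N ->
    exists2 m', m' \in s & forall k, bcomp k m' = bcomp k m.
Proof.
(* Lists that are too long and parts that are too large get default values, but [code] is faithful
   in degree at most [N]. *)
pose code (m : mono (vars n)) : {ffun 'I_n -> N.-bseq (bool * 'I_N.+1)%type} :=
  [ffun k => insub_bseq N [seq (x.1, inord x.2) | x <- bcomp k m]].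
(* Each variable of the support adds at least 1 to the degree, which bounds the number of parts. *)
have part_le (m : mono (vars n)) v : v \in finsupp m -> (0 < (m v).2 + (m v).1)%N.
  by rewrite mem_finsupp; case: (m v) => -[] [|i].
have code_inj m m' : (xdeg m + tdeg m <= N)%N -> (xdeg m' + tdeg m' <= N)%N ->
    code m = code m' -> forall k, bcomp k m = bcomp k m'.
  move=> mN m'N mm' k; have : val (code m k) = val (code m' k) by rewrite mm'.
  have bnd (m0 : mono (vars n)) : (xdeg m0 + tdeg m0 <= N)%N ->
      (size (bcomp k m0) <= N)%N /\ forall x, x \in bcomp k m0 -> (x.2 <= N)%N.
    move=> h; split.
      apply: leq_trans h; rewrite size_map size_filter.
      apply: leq_trans (count_size _ _) _; rewrite size_sort (deg_sumE (fsubset_refl _)).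
      by rewrite -sum1_size big_seq [X in (_ <= X)%N]big_seq; apply: leq_sum => v /part_le.
    move=> _ /mapP[v + ->]; rewrite mem_filter mem_msupp => /andP[_ vm].
    apply: leq_trans h; rewrite (deg_sumE (fsubset_refl _)) (big_fsetD1 v) //=.
    by rewrite -addnA leq_addr.
  have [[s1 b1] [s2 b2]] := (bnd _ mN, bnd _ m'N).
  rewrite !ffunE !insubdK; try by rewrite unfold_in size_map.
  move=> /(congr1 (map (fun x => (x.1, val x.2)))).
  rewrite -(map_comp _ _ (bcomp k m)) -(map_comp _ _ (bcomp k m')) => E.
  rewrite -[LHS]map_id -[RHS]map_id.
  transitivity [seq ((fun x : bool * 'I_N.+1 => (x.1, val x.2)) \o
    (fun x : bool * nat => (x.1, inord x.2))) x | x <- bcomp k m].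
    by apply/eq_in_map => x /b1 xN; rewrite /= inordK // -surjective_pairing.
  rewrite E; apply/eq_in_map => x /b2 xN.
  by rewrite /= inordK // -surjective_pairing.
have /choice[rep repP] c : exists r : mono (vars n),
    (exists m, (xdeg m + tdeg m <= N)%N /\ code m = c) ->
    (xdeg r + tdeg r <= N)%N /\ code r = c.
  have [[m mP]|h] := pselect (exists m, (xdeg m + tdeg m <= N)%N /\ code m = c).
    by exists m.
  by exists mono1 => /h.
exists [seq rep c | c <- enum {: {ffun 'I_n -> N.-bseq (bool * 'I_N.+1)%type}}] => m mN.
have [rN rc] := repP (code m) (ex_intro _ m (conj mN erefl)).
exists (rep (code m)); last exact: code_inj.
by apply: map_f; rewrite mem_enum.
Qed.

(** * Tensor products of spaces of series *)

Section HopfFamily.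
Variable F : series_family.
Hypothesis hF : hopf_family F.
Local Notation FT := (family_type F).
Local Notation pl p q := (pull (@lshift p q)).
Local Notation pr p q := (pull (@rshift p q)).

Lemma family_ext n (f g : FT n) : (forall m, family_val f m = family_val g m) -> f = g.
Proof. by move=> fg; apply/val_inj/funext. Qed.

Lemma family_valD n (f g : FT n) m :
  family_val (f + g) m = family_val f m + family_val g m.
Proof. by []. Qed.

Lemma family_valZ n k (f : FT n) m : family_val (k *: f) m = k * family_val f m.
Proof. by []. Qed.

Lemma family_val0 n m : family_val (0 : FT n) m = 0.
Proof. by []. Qed.

Lemma family_val_sum n (T : Type) (s : seq T) (G : T -> FT n) m :
  family_val (\sum_(x <- s) G x) m = \sum_(x <- s) (family_val (G x) m : rat).
Proof. exact: (big_morph (fun f : FT n => family_val f m)). Qed.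

Lemma tensorE p q (f : FT p) (g : FT q) m :
  family_val (tensor f g) m = family_val f (pl p q m) * family_val g (pr p q m).
Proof. exact: mul_renameE. Qed.

Lemma tensor_joinE p q (f : FT p) (g : FT q) a b :
  family_val (tensor f g) (join a b) = family_val f a * family_val g b.
Proof. by rewrite tensorE pull_joinl pull_joinr. Qed.

Definition slicel p q (b : mono (vars q)) (f : FT (p + q)) : FT p :=
  FamilyElt (hf_slicel hF b (valP f)).

Definition slicer p q (a : mono (vars p)) (f : FT (p + q)) : FT q :=
  FamilyElt (hf_slicer hF a (valP f)).

Lemma tensor_bilinear p q : bilinear_map (@tensor F p q).
Proof.
split=> [f|g] k x y; apply: family_ext => m;
  rewrite family_valD family_valZ !tensorE !family_valD !family_valZ.
  by rewrite mulrDr mulrCA.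
by rewrite mulrDl mulrA.
Qed.

(* Gaussian elimination on the matrix f (join a b), which has finitely many
   different columns. *)
Lemma tensor_spans p q (x : FT (p + q)) :
  exists s : seq (FT p * FT q), x = \sum_(y <- s) tensor y.1 y.2.
Proof.
have [N xN] := hf_bounded hF (valP x).
have [B BP] := bounded_representatives q N.
have bN : forall a b, family_val x (join a b) != 0 -> (xdeg b + tdeg b <= N)%N.
  move=> a b /xN; apply: leq_trans.
  by rewrite xdeg_join tdeg_join !pull_joinr leq_add ?leq_addl.
(* The induction runs over the representative columns that may still be nonzero; at first this is
   all of [B] and the invariant is vacuous. *)
have zB b : b \in B -> b \notin B -> forall a, family_val x (join a b) = 0.
  by move=> ->.
clear xN; move: {2}B zB => s; elim: s x bN => [|b0 s IH] x bN zB.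
  (* All representative columns vanish here, and by quasisymmetry of the rows every column within
     the degree bound equals one of them. *)
  exists [::]; rewrite big_nil; apply: family_ext => m; rewrite family_val0.
  apply/eqP; rewrite -[m]joinK; apply: contraT => xm.
  have [b' b'B bb'] := BP _ (bN _ _ xm).
  rewrite -(negbTE xm) -(zB b' b'B isT (pl p q m)); apply/eqP.
  have sq := hf_quasisymmetric hF (valP (slicer (pl p q m) x)).
  by apply: (sq _ _) => k; rewrite bb'.
have [[a0 x0]|x0] := pselect (exists a, family_val x (join a b0) != 0); last first.
  apply: IH => // b bB bs a; have [->|bb0] := eqVneq b b0.
    by apply/eqP; apply: contraPT isT => xa; case: x0; exists a.
  by apply: zB; rewrite // inE negb_or bb0.
(* With the pivot [(a0, b0)], subtracting [tensor u v] clears the column of [b0], keeps zero columns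
   zero and respects the degree bound. *)
pose u := (family_val x (join a0 b0))^-1 *: slicel b0 x.
pose v := slicer a0 x.
have yE a b : family_val (x - tensor u v) (join a b) = family_val x (join a b) -
    (family_val x (join a0 b0))^-1 * family_val x (join a b0) * family_val x (join a0 b).
  by rewrite -scaleN1r family_valD family_valZ mulN1r tensor_joinE.
have [||r rE] := IH (x - tensor u v).
- move=> a b; rewrite yE => h; have [xa0|/bN//] := eqVneq (family_val x (join a0 b)) 0.
  by move: h; rewrite xa0 mulr0 subr0 => /bN.
- move=> b bB bs a; rewrite yE; have [->|bb0] := eqVneq b b0.
    by rewrite mulrAC mulVf // mul1r subrr.
  have zb a' : family_val x (join a' b) = 0 by apply: zB; rewrite // inE negb_or bb0.
  by rewrite !zb mulr0 subrr.
by exists ((u, v) :: r); rewrite big_cons /= -rE addrC subrK.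
Qed.

(** A nonzero [u] has a nonzero coefficient at some [a]; this coefficient and the row at [a] provide
    the functional and its contraction. *)
Lemma tensor_is_tensor p q : is_tensor (@tensor F p q).
Proof.
apply: is_tensor_intro; [exact: tensor_bilinear | exact: tensor_spans|].
move=> u u0; have [a ua] : exists a, family_val u a != 0.
  apply: contrapT => h; case/negP: u0; apply/eqP/family_ext => m.
  by rewrite family_val0; apply/eqP; apply: contraPT isT => um; case: h; exists m.
exists (fun f => family_val f a), (slicer a); split=> // [k f g|u' v].
  by apply: family_ext => b.
by apply: family_ext => b; rewrite family_valZ -tensor_joinE.
Qed.

End HopfFamily.

Section ProductMonomials.
Context {d : Order.disp_t} {I : orderType d}.

Lemma mmul_eq1 (a b : mono I) : mmul a b = mono1 -> a = mono1 /\ b = mono1.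
Proof.
move=> ab; split; apply/fsfunP => i; move: (congr1 (fun m : mono I => m i) ab);
  rewrite mmulE !mono1E; by case: (a i) (b i) => -[] [|?] [[] [|?]].
Qed.

Lemma smul_mono1 (f g : series I) : (f * g) mono1 = f mono1 * g mono1.
Proof.
rewrite smulE -(fsbig_widen [set (mono1, mono1)]).
- by rewrite fsbig_set1 /= msign1m mul1r.
- by move=> _ -> /=; rewrite mmul1m.
- by move=> [a b] [/= /mmul_eq1[-> ->]].
Qed.

Lemma smul_neq0 (f g : series I) m : (f * g) m != 0 ->
  exists a b, [/\ m = mmul a b, msign a b != 0, f a != 0 & g b != 0].
Proof.
move=> fg; apply: contrapT => h; case/eqP: fg; rewrite smulE fsbig1 // => -[a b] /= abm.
apply/eqP; apply: contraPT isT; rewrite !mulf_eq0 !negb_or => /and3P[sab fa gb].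
by case: h; exists a, b.
Qed.

Lemma deg_eq0 (m : mono I) : (xdeg m + tdeg m == 0)%N = (m == mono1).
Proof.
rewrite (deg_sumE (fsubset_refl _)); apply/eqP/eqP => [m0|->]; last first.
  by rewrite finsupp0 big_seq_fset0.
apply/fsfunP => i; rewrite mono1E; have [im|/fsfun_dflt//] := boolP (i \in finsupp m).
move/eqP: m0; rewrite sum_nat_seq_eq0 => /allP/(_ i im) /=.
by case: (m i) => -[] [|?].
Qed.

End ProductMonomials.

(** The sign comes from moving the renamed [f2] past the renamed [g1], whose fermionic degrees are
    [q] and [p]. *)
Lemma tensor_mul r s p q (f1 f2 : series (vars r)) (g1 g2 : series (vars s)) :
  (forall m, g1 m != 0 -> tdeg m = p) -> (forall m, f2 m != 0 -> tdeg m = q) ->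
  (rename_sets (@lshift r s) f1 * rename_sets (@rshift r s) g1) *
  (rename_sets (@lshift r s) f2 * rename_sets (@rshift r s) g2) =
  (-1) ^+ (p * q) *:
    (rename_sets (@lshift r s) (f1 * f2) * rename_sets (@rshift r s) (g1 * g2)).
Proof.
move=> g1p f2q.
rewrite (rename_mul (@lshift_homo r s)) (rename_mul (@rshift_homo r s)) -!mulrA.
rewrite [rename_sets _ g1 * (_ * _)]mulrA 
  [rename_sets _ g1 * _](smulC (p := p) (q := q)).
- by rewrite -scalerAl -scalerAr !mulrA.
- exact: rename_tdeg (@rshift_homo r s) _ _ g1p.
- exact: rename_tdeg (@lshift_homo r s) _ _ f2q.
Qed.

(** * Verification of the Hopf algebra axioms *)

Section HopfStructure.
Variable F : series_family.
Hypothesis hF : hopf_family F.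
Local Notation FT := (family_type F).
Local Notation pl p q := (pull (@lshift p q)).
Local Notation pr p q := (pull (@rshift p q)).

Lemma tensorA (f g h : FT 1) :
  tensor (tensor f g) h = tensor f (tensor g h) :> FT 3.
Proof.
apply: family_ext => m; apply: etrans (tensorE (tensor f g) h m) _.
apply: etrans (esym (tensorE f (tensor g h) m)); rewrite !tensorE -mulrA.
(* The two nestings of alphabets produce ordinals with equal values but different bound proofs. *)
by congr (_ * (_ * _)); congr (family_val _ _); apply/fsfunP => v; rewrite !pullE;
  congr (m (_, _)); apply: val_inj.
Qed.

Section Grading.
Variables (n : nat) (delta : nat -> nat -> nat).
Hypothesis delta_le : forall x t, (delta x t <= x + t)%N.
Local Notation part := (fun i => [set f : FT n |
  forall m, family_val f m != 0 -> delta (xdeg m) (tdeg m) = i]).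

Definition truncate (i : nat) (f : FT n) : FT n :=
  FamilyElt (hf_truncate hF (fun x t => delta x t == i) (valP f)).

Lemma truncateE i f m :
  family_val (truncate i f) m = if delta (xdeg m) (tdeg m) == i then family_val f m else 0.
Proof. by []. Qed.

Lemma truncate_part i f : part i (truncate i f).
Proof. by move=> m; rewrite truncateE; case: ifP => [/eqP|]; rewrite ?eqxx. Qed.

(** Bounded degree and [delta_le] leave finitely many components. The sum as [delta] gives the total
    degree, the second projection the fermionic one. *)
Lemma parts_grading : is_grading part.
Proof.
split.
- move=> i; split=> [|k u v ui vi m]; first by move=> m; rewrite family_val0 eqxx.
  have [u0|/ui//] := eqVneq (family_val u m) 0.
  by rewrite family_valD family_valZ u0 mulr0 add0r => /vi.
- move=> f; have [N fN] := hf_bounded hF (valP f).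
  exists N.+1, (truncate^~ f); split=> [i|]; first exact: truncate_part.
  apply: family_ext => m; rewrite family_val_sum; cbv beta.
  have [f0|/fN mN] := eqVneq (family_val f m) 0.
    by rewrite f0 big1 // => i _; rewrite truncateE f0 if_same.
  have dN : (delta (xdeg m) (tdeg m) < N.+1)%N by rewrite ltnS (leq_trans (delta_le _ _)).
  rewrite (bigD1 (Ordinal dN)) //= eqxx big1 ?addr0 // => i.
  by rewrite -val_eqE /= eq_sym => /negbTE ->.
- move=> N c cP c0 i iN; apply: family_ext => m; rewrite family_val0.
  apply/eqP; apply: contraT => /[dup] cm /cP mi.
  have := congr1 (fun f : FT n => family_val f m) c0.
  rewrite family_val_sum family_val0 (bigD1 (Ordinal iN)) //= big1 ?addr0.
    by move=> /eqP; rewrite (negbTE cm).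
  move=> j; rewrite -val_eqE /= => ji; apply/eqP; apply: contraNT ji => /cP <-.
  by rewrite mi.
Qed.

End Grading.

Lemma eval_degE n (m : mono (vars n)) :
  xdeg (comp_mono (Defs.comp m)) = xdeg m /\ tdeg (comp_mono (Defs.comp m)) = tdeg m.
Proof. by rewrite !xdeg_comp !tdeg_comp comp_comp_mono. Qed.

(** An arbitrary expression by pure tensors is cut down to the bidegrees [(i, n - i)]. The discarded
    terms cancel because the coproduct itself is homogeneous of degree [n]. *)
Lemma coproduct_homogeneous n (f : FT 1) : @total_part F n f ->
  exists s : seq (FT 1 * FT 1), coproduct f = \sum_(x <- s) tensor x.1 x.2 /\
    forall x, x \in s -> exists i j,
      [/\ (i + j)%N = n, @total_part F i x.1 & @total_part F j x.2].
Proof.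
move=> fn; have [s fs] := tensor_spans hF (p := 1) (q := 1) (coproduct f).
pose tr := truncate (n := 1) addn.
exists [seq (tr i y.1, tr (n - i)%N y.2) | y <- s, i <- iota 0 n.+1]; split; last first.
  move=> _ /allpairsP[[y i] [_ + ->]]; rewrite mem_iota ltnS => /= iN.
  by exists i, (n - i)%N; split; [rewrite subnKC | exact: truncate_part..].
apply: family_ext => m; rewrite family_val_sum big_allpairs_dep.
have [mn|mn] := eqVneq (xdeg m + tdeg m)%N n; last first.
  have -> : family_val (coproduct f) m = 0.
    apply/eqP; apply: contraNT mn => /fn.
    by have [-> ->] := eval_degE m => /eqP.
  rewrite big1 // => y _; rewrite big1_seq // => i /andP[_].
  rewrite mem_iota add0n ltnS leq0n => iN; rewrite tensorE !truncateE.
  case: eqP => [li|]; last by rewrite mul0r.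
  case: eqP => [ri|]; last by rewrite mulr0.
  case/eqP: mn; rewrite (xdeg_join (p := 1) (q := 1)) (tdeg_join (p := 1) (q := 1)).
  by rewrite addnACA li ri subnKC.
rewrite fs family_val_sum; apply: eq_bigr => y _; rewrite tensorE.
set l := pl 1 1 m; set r := pr 1 1 m.
have lr : (xdeg l + tdeg l + (xdeg r + tdeg r))%N = n.
  by rewrite addnACA -(xdeg_join (p := 1) (q := 1)) -(tdeg_join (p := 1) (q := 1)).
have li : (xdeg l + tdeg l)%N \in iota 0 n.+1 by rewrite mem_iota /= ltnS -lr leq_addr.
apply/esym; rewrite (eq_big_seq (fun i => if i == (xdeg l + tdeg l)%N
    then family_val y.1 l * family_val y.2 r else 0)) => [|i].
  by rewrite (bigD1_seq _ li) ?iota_uniq //= eqxx big1 ?addr0 // => i /negbTE ->.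
rewrite mem_iota add0n ltnS leq0n => iN; rewrite tensorE !truncateE [i == _]eq_sym -/l -/r.
case: eqP => [<-|_]; last by rewrite mul0r.
by rewrite -lr addKn eqxx.
Qed.

Let tT := tensor_is_tensor hF 1 1 : is_tensor (@hd_tens (family_hopf F)).
Let tT21 := tensor_is_tensor hF 2 1 : is_tensor (@hd_tens21 (family_hopf F)).
Let tT12 := tensor_is_tensor hF 1 2 : is_tensor (@hd_tens12 (family_hopf F)).

Lemma family_coalgebra : is_coalgebra (family_hopf F).
Proof.
have Dl : linear (@coproduct F) by move=> k f g; apply: family_ext.
have el : scalar (@constant_term F) by [].
have lid : linear (id : FT 1 -> FT 1) by [].
have DJ (f : FT 1) (a b : mono (vars 1)) : family_val (coproduct f) (join a b) =
    family_val f (comp_mono (Defs.comp a ++ Defs.comp b)).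
  by rewrite -comp_joinE.
have fE (f : FT 1) m : family_val f (comp_mono (Defs.comp m)) = family_val f m.
  by apply: (quasisymmetric_compE (hf_quasisymmetric hF (valP f))); rewrite comp_comp_mono.
have comp1 : Defs.comp (mono1 : mono (vars 1)) = [::] by apply/eqP; rewrite comp0.
split=> //; first exact: tensorA.
- move=> f; have [s fs] := tensor_spans hF (p := 1) (q := 1) (coproduct f).
  rewrite /= /tensor_map fs !(tensor_lift_sum tT).
  + apply: family_ext => m; rewrite !family_val_sum.
    (* A monomial in three alphabets is split as 2 + 1 on one side and as 1 + 2 on the other; either
       way the result is the coefficient of [f] at its whole composition. *)
    transitivity (family_val (coproduct f)
      (join (comp_mono (Defs.comp (pl 2 1 m))) (pr 2 1 m))).
      rewrite fs family_val_sum; apply: eq_bigr => x _.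
      by rewrite tensor_joinE; exact: (@tensorE _ 2 1 (coproduct x.1) x.2 m).
    transitivity (family_val (coproduct f)
      (join (pl 1 2 m) (comp_mono (Defs.comp (pr 1 2 m))))); last first.
      rewrite fs family_val_sum; apply: eq_bigr => x _.
      by rewrite tensor_joinE; apply/esym; exact: (@tensorE _ 1 2 x.1 (coproduct x.2) m).
    by rewrite !DJ !comp_comp_mono -(@comp_join 2 1 m) -(@comp_join 1 2 m).
  + exact: bilin_comp (tensor_bilin tT12) lid Dl.
  + exact: bilin_comp (tensor_bilin tT21) Dl lid.
- move=> f; have [s fs] := tensor_spans hF (p := 1) (q := 1) (coproduct f).
  rewrite /= fs (tensor_lift_sum tT); last first.
    split=> [u|v] k x y; first by rewrite scalerDr !scalerA mulrC.
    by rewrite el scalerDl scalerA.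
  apply: family_ext => m; rewrite family_val_sum.
  transitivity (family_val (coproduct f) (join (mono1 : mono (vars 1)) m)).
    rewrite fs family_val_sum; apply: eq_bigr => x _.
    by rewrite tensor_joinE family_valZ.
  by rewrite DJ comp1 ?cats0 fE.
- move=> f; have [s fs] := tensor_spans hF (p := 1) (q := 1) (coproduct f).
  rewrite /= fs (tensor_lift_sum tT); last first.
    split=> [u|v] k x y; last by rewrite scalerDr !scalerA mulrC.
    by rewrite el scalerDl scalerA.
  apply: family_ext => m; rewrite family_val_sum.
  transitivity (family_val (coproduct f) (join m (mono1 : mono (vars 1)))).
    rewrite fs family_val_sum; apply: eq_bigr => x _.
    by rewrite tensor_joinE family_valZ mulrC.
  by rewrite DJ comp1 ?cats0 fE.
Qed.

Lemma family_connected : is_connected (family_hopf F).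
Proof.
exists 1; first exact: oner_neq0.
have val1 m : family_val (1 : FT 1) m = (m == mono1)%:R by [].
move=> f; split=> [f0|[k ->] m]; last first.
  rewrite family_valZ val1; have [->|_] := eqVneq m mono1; last by rewrite mulr0 eqxx.
  by move=> _; apply/eqP; rewrite deg_eq0.
exists (family_val f mono1); apply: family_ext => m; rewrite family_valZ val1.
have [->|m1] := eqVneq m mono1; first by rewrite mulr1.
by rewrite mulr0; apply/eqP; apply: contraNT m1 => /f0/eqP; rewrite deg_eq0.
Qed.

Lemma family_supercommutative : is_supercommutative (family_hopf F).
Proof.
move=> p q f g fp gq; apply: val_inj.
exact: (@smulC _ _ p q (family_val f) (family_val g) fp gq).
Qed.

Lemma family_graded_hopf : is_graded_hopf_algebra (family_hopf F).
Proof.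
(* The coalgebra axioms, the gradings and the facts about 1 are put in the context, where
   [split=> //] finds them. *)
have [? ? ? ? ? ? ? ? ?] := family_coalgebra.
have gdeg : is_grading (@hd_deg (family_hopf F)) :=
  @parts_grading 1 addn (fun x t => leqnn _).
have gfdeg : is_grading (@hd_fdeg (family_hopf F)) :=
  @parts_grading 1 (fun _ t => t) leq_addl.
have val1 m : family_val (1 : FT 1) m = (m == mono1)%:R by [].
have deg1 : @hd_deg (family_hopf F) 0 1.
  move=> m; rewrite val1; have [->|_] := eqVneq m mono1.
    by move=> _; apply/eqP; rewrite deg_eq0.
  by rewrite eqxx.
have eps1 : @hd_counit (family_hopf F) 1 = 1 by apply: etrans (val1 _) _; rewrite eqxx.
split=> //.
- move=> p q f g fp gq m fgm.
  have [a [b [-> /tdeg_mmul-> /fp fa /gq gb]]] :=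
    @smul_neq0 _ _ (family_val f) (family_val g) m fgm.
  by rewrite fa gb.
- move=> p q f g fp gq m fgm.
  have [a [b [-> /tdeg_mmul E /fp fa /gq gb]]] :=
    @smul_neq0 _ _ (family_val f) (family_val g) m fgm.
  by rewrite xdeg_mmul E addnACA fa gb.
- exact: coproduct_homogeneous.
- move=> n f n0 fn; apply/eqP; apply: contraT => /fn/esym nE.
  by move: n0; rewrite nE lt0n deg_eq0 eqxx.
- apply: family_ext => m; rewrite tensorE !val1 -[LHS]/((m == mono1)%:R).
  by rewrite (@join_eq1 1 1) -mulnb natrM.
- move=> p q f1 g1 f2 g2 g1p f2q; apply: val_inj.
  exact: (@tensor_mul 1 1 p q f1 f2 g1 g2 g1p f2q).
- exact/val_inj/eval_sets1.
- move=> f g; apply: val_inj.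
  apply: (@eval_setsM 2 (family_val f) (family_val g));
    exact: (hf_quasisymmetric hF (valP _)).
- by move=> f g; exact: (smul_mono1 (family_val f) (family_val g)).
- exact: (graded_connected_antipode family_coalgebra gdeg coproduct_homogeneous eps1
    family_connected deg1).
Qed.

End HopfStructure.

(** * The inclusion of symmetric functions *)

Lemma symmetric_in_quasisymmetric n (f : family_type symmetric_family n) :
  family_val f \in in_family quasisymmetric_family n.
Proof.
have hS := symmetric_hopf_family; apply/asboolP; split.
  exact: (hf_bounded hS (valP f)).
exact: (hf_quasisymmetric hS (valP f)).
Qed.

Definition symmetric_inclusion (f : Lambda) : sQSym :=
  FamilyElt (symmetric_in_quasisymmetric f).

Lemma symmetric_inclusion_embedding : is_hopf_embedding symmetric_inclusion.
Proof.
have [hS hQ] := (symmetric_hopf_family, quasisymmetric_hopf_family).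
have [coS coQ] := (family_coalgebra hS, family_coalgebra hQ).
have il : linear symmetric_inclusion by move=> k f g; apply: family_ext.
(* The coproduct is expressed by pure tensors inside [Lambda]; the same ones express it in [sQSym],
   since both coproducts are the same series. *)
have iD f : hd_coprod (symmetric_inclusion f) = tensor_map (@hd_tens Lambda)
    (@hd_tens sQSym) symmetric_inclusion symmetric_inclusion (hd_coprod f).
  have [s fs] := tensor_spans hS (p := 1) (q := 1) (coproduct f).
  rewrite /= /tensor_map fs (tensor_lift_sum (co_tensor coS)); last first.
    exact: (bilin_comp (tensor_bilin (co_tensor coQ)) il il).
  apply: family_ext => m; rewrite family_val_sum.
  transitivity (family_val (coproduct f) m) => //.
  by rewrite fs family_val_sum; apply: eq_bigr => x _; rewrite !tensorE.
have i1 : symmetric_inclusion 1 = 1 by apply: family_ext.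
have iM : {morph symmetric_inclusion : f g / f * g} by move=> f g; apply: family_ext.
split=> // [f g fg|SB SA].
  apply: family_ext => m; exact: (congr1 (fun h : sQSym => family_val h m) fg).
exact: (bialgebra_map_antipode coS coQ il i1 iM iD (fun=> erefl)).
Qed.

Theorem proposition5p9 :
  (is_graded_hopf_algebra sQSym /\ is_connected sQSym /\ is_supercommutative sQSym) /\
  (is_graded_hopf_algebra Lambda /\
   exists i : Lambda -> sQSym,
     (forall f, family_val (i f) = family_val f) /\ is_hopf_embedding i).
Proof.
have [hS hQ] := (symmetric_hopf_family, quasisymmetric_hopf_family).
split; first split; first exact: family_graded_hopf.
  by split; [exact: family_connected | exact: family_supercommutative].
split; first exact: family_graded_hopf.
by exists symmetric_inclusion; split; last exact: symmetric_inclusion_embedding.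
Qed.
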